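(* Let $T\in\mathcal{T}_{\rm ar}$ be an arborescent tangle and let $\rho\in\mathcal{R}(T)$. Let $\ell\in\{1,2\}$. (i) Let $\{\alpha,\beta\}=\{e,w\}$. If $\rho^{\alpha}$ is NR$_\ell$, then ${\rm tr}_v(\rho)=2a$ and ${\rm tr}_h(\rho)=2b$ with $a,b\in\{\pm1\}$, $\rho^{\beta}=-b\,\rho^{\alpha}C_a(u)$ for some $u\in\mathbb{Q}$, and $\rho^{\beta}$ is also NR$_\ell$; moreover, $u\neq 0$ if and only if $\rho^n,\rho^s$ are NR$_\ell$. (ii) Let $\{\alpha,\beta\}=\{n,s\}$. If $\rho^{\alpha}$ is NR$_\ell$, then ${\rm tr}_v(\rho)=2a$ and ${\rm tr}_h(\rho)=2b$ with $a,b\in\{\pm1\}$, $\rho^{\beta}=-a\,\rho^{\alpha}C_b(v)$ for some $v\in\mathbb{Q}$, and $\rho^{\beta}$ is also NR$_\ell$; moreover, $v\neq 0$ if and only if $\rho^w,\rho^e$ are NR$_\ell$. (iii) If ${\rm tr}_v(\rho)\notin\{\pm2\}$, then $\rho^n,\rho^w,\rho^s,\rho^e$ are all R, and there exists a unique $[a,b]\in\mathcal{U}$ with $t([a,b])=({\rm tr}_v(\rho),{\rm tr}_h(\rho))$ and $\rho^e=-\rho^w S_{[a,b]}$. (iv) If ${\rm tr}_h(\rho)\notin\{\pm2\}$, then $\rho^n,\rho^w,\rho^s,\rho^e$ are all R, and there exists a unique $[a,b]\in\mathcal{U}$ with $t([a,b])=({\rm tr}_v(\rho),{\rm tr}_h(\rho))$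 and $\rho^s=-\rho^n S_{[b,a]}$. (In any case, the class $[a,b]\in\mathcal{U}$ is denoted $\chi(\rho)$.)
   Context: Tangles. A 2-tangle $T$ is an embedding of $[0,1]\sqcup[0,1]\sqcup mS^1$ ($m\ge 0$) in a 3-ball $B^3$ meeting $\partial B^3$ in four fixed points, named NW, NE, SW, SE; tangles are considered up to isotopy fixing $\partial B^3$ and are represented by planar diagrams. $\mathcal{T}_2$ is the set of 2-tangles. $[1]$ and $[-1]$ are the single-crossing tangles with strands NW–SE and SW–NE; in $[1]$ the over-strand is NW–SE, in $[-1]$ the over-strand is SW–NE. The horizontal composition $T_1+T_2$ places $T_1$ to the left of $T_2$ and joins the NE, SE ends of $T_1$ to the NW, SW ends of $T_2$ respectively; the vertical composition $T_1\ast T_2$ places $T_1$ above $T_2$ and joins the SW, SE ends of $T_1$ to the NW, NE ends of $T_2$ respectively. $\mathcal{T}_{\rm ar}$ (arborescent tangles) is the smallest subset of $\mathcal{T}_2$ containing $[\pm1]$ and closed under $+$ and $\ast$. Representations. ${\rm SL}^0(2,\mathbb{C})$ is the set of trace-zero matrices in ${\rm SL}(2,\mathbb{C})$ (so $X^{-1}=-X$ for such $X$). A representation of $T$ is a homomorphism $\pi_1(B^3-T)\to{\rm SL}(2,\mathbb{C})$ sending every meridian into ${\rm SL}^0(2,\mathbb{C})$. Equivalently (Wirtinger presentation), with $\mathcal{D}(T)$ the set of directed arcs of a diagram of $T$ and $x^{-1}$ denoting the arc $x$ with reversed direction, it is a map $\rho:\mathcal{D}(T)\to{\rm SL}^0(2,\mathbb{C})$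 with $\rho(x^{-1})=\rho(x)^{-1}=-\rho(x)$ and $\rho(z)=\rho(x)\rho(y)\rho(x)^{-1}=-{\rm tr}(\rho(x)\rho(y))\rho(x)-\rho(y)$ at each crossing with over-arc $x$ and under-arcs $y,z$ directed coherently along the under-strand. $\mathcal{R}(T)$ is the set of representations of $T$. Let $\rho^{\rm nw},\rho^{\rm ne},\rho^{\rm sw},\rho^{\rm se}$ be the values of $\rho$ on the arcs ending at NW, NE, SW, SE, directed outwards. Put $\rho^w=(\rho^{\rm nw},\rho^{\rm sw})$, $\rho^e=(\rho^{\rm ne},\rho^{\rm se})$, $\rho^n=(\rho^{\rm nw},\rho^{\rm ne})$, $\rho^s=(\rho^{\rm sw},\rho^{\rm se})$, and ${\rm tr}_v(\rho)={\rm tr}(\rho^{\rm nw}\rho^{\rm sw})={\rm tr}(\rho^{\rm ne}\rho^{\rm se})$, ${\rm tr}_h(\rho)={\rm tr}(\rho^{\rm nw}\rho^{\rm ne})={\rm tr}(\rho^{\rm sw}\rho^{\rm se})$. Matrices. For $a\in\mathbb{C}^\times$ put $t(a)=a+a^{-1}$, $s(a)=a-a^{-1}$, and $$A_1(a)=\frac12\begin{pmatrix}t(a)i&s(a)\\ s(a)&-t(a)i\end{pmatrix},\quad A=A_1(1)=\begin{pmatrix}i&0\\0&-i\end{pmatrix},\quad B_1=\begin{pmatrix}i&1\\0&-i\end{pmatrix},\quad B_2=\begin{pmatrix}i&0\\1&-i\end{pmatrix}.$$ A pair $(X,Y)$ of matrices is multiplied on the right by a $2\times2$ scalar matrix $M=(m_{ij})$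 as a row vector: $(X,Y)M=(m_{11}X+m_{21}Y,\ m_{12}X+m_{22}Y)$. For $c\in\{\pm1\}$, $u\in\mathbb{C}$, $$C_c(u)=\begin{pmatrix}1+u&-cu\\ cu&1-u\end{pmatrix}.$$ For $a,b\in\mathbb{C}^\times$ with $a\notin\{\pm1\}$, $$S_{(a,b)}=\frac{1}{s(a)}\begin{pmatrix}s(ab^{-1})&s(b)\\-s(b)&s(ab)\end{pmatrix}.$$ $\mathcal{U}$ is the quotient of $\mathbb{C}^\times\times\mathbb{C}^\times$ by $(a,b)\sim(a^{-1},b^{-1})$; $[a,b]$ is the class of $(a,b)$. Since $S_{(a,b)}=S_{(a^{-1},b^{-1})}$, write $S_{[a,b]}=S_{(a,b)}$. The map $t:\mathcal{U}\to\mathbb{C}^2$, $t([a,b])=(t(a),t(b))$, is well defined. Regular pairs. For $X,Y,X',Y'\in{\rm SL}^0(2,\mathbb{C})$ write $(X,Y)\sim(X',Y')$ if there is $Z\in{\rm SL}(2,\mathbb{C})$ with $ZXZ^{-1}=X'$ and $ZYZ^{-1}=Y'$. If ${\rm tr}(XY)=t(a)$, the pair $(X,Y)$ is regular (R) if $(X,Y)\sim(A,-A_1(a))$, and non-regular (NR) otherwise. $(X,Y)$ is NR if and only if $a\in\{\pm1\}$ and $X\neq-aY$, in which case $(X,Y)\sim(A,-aB_\ell)$ for exactly one $\ell\in\{1,2\}$; then $(X,Y)$ is called NR of type $\ell$ (NR$_\ell$).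
   Formalization: The printed types NR_ℓ in the conclusions of (i), (ii) are false (T=[1], ρ^nw=A, ρ^sw=−B_1: ρ^w is NR_1, u=1, but ρ^s is NR_2); corrected: ρ^e has the type of ρ^w iff b=−1 and ρ^s that of ρ^n iff a=−1, otherwise the types are swapped; ρ^n and ρ^w share a type. *)

(* Defs.v *)
From HB Require Import structures.
From mathcomp Require Import all_boot all_order all_algebra.
From mathcomp Require Import generic_quotient.
From mathcomp Require Import reals.
From mathcomp.real_closed Require Import complex.

Set Implicit Arguments.
Unset Strict Implicit.
Unset Printing Implicit Defensive.

Import Order.TTheory GRing.Theory Num.Theory.

(* A planar diagram in Morse position, read from top to bottom, is the list of
   its elementary pieces.  The pair (e, i) places the piece e on the strands
   numbered i, i + 1 (from left to right, starting at 0), all other strands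
   being vertical.  Lmax is a local maximum (it creates the strands i and
   i + 1), Lmin a local minimum (it joins the strands i and i + 1).  In
   Cross true the over-strand runs from the upper left to the lower right, in
   Cross false from the lower left to the upper right. *)
Inductive piece := Lmax | Lmin | Cross of bool.

Definition diagram := seq (piece * nat).

Definition ins (e : piece) : nat := if e is Lmax then 0 else 2.
Definition outs (e : piece) : nat := if e is Lmin then 0 else 2.

(* Number of strands below D, when there are n strands above D. *)
Definition width (n : nat) (D : diagram) : nat :=
  foldl (fun w ei => w - ins ei.1 + outs ei.1) n D.

Fixpoint wf (n m : nat) (D : diagram) : bool :=
  if D is (e, i) :: D' then
    (i + ins e <= n) && wf (n - ins e + outs e) m D'
  else n == m.

(* The ends NW, NE are the strands 0, 1 at the top, and SW, SE the strands
   0, 1 at the bottom. *)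
Definition tangle2 (D : diagram) : bool := wf 2 2 D.

(* Local moves generating isotopy rel boundary of unoriented tangle diagrams
   in Morse position: planar isotopy (the first five) and the Reidemeister
   moves.  [move_R3] involves strands p, q, r (numbered at the top) with p over q
   iff b1, p over r iff b2, q over r iff b3; its side condition excludes the
   two cyclic, hence unrealizable, choices. *)
Inductive move : diagram -> diagram -> Prop :=
| move_far e1 e2 i d :
    move [:: (e1, i); (e2, i + outs e1 + d)]
         [:: (e2, i + ins e1 + d); (e1, i)]
| move_zigzag_l i : move [:: (Lmax, i); (Lmin, i.+1)] [::]
| move_zigzag_r i : move [:: (Lmax, i.+1); (Lmin, i)] [::]
| move_slide_max b i :
    move [:: (Lmax, i); (Cross b, i.+1)] [:: (Lmax, i.+1); (Cross (~~ b), i)]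
| move_slide_min b i :
    move [:: (Cross b, i.+1); (Lmin, i)] [:: (Cross (~~ b), i); (Lmin, i.+1)]
| move_R1_max b i : move [:: (Lmax, i); (Cross b, i)] [:: (Lmax, i)]
| move_R1_min b i : move [:: (Cross b, i); (Lmin, i)] [:: (Lmin, i)]
| move_R2 b i : move [:: (Cross b, i); (Cross (~~ b), i)] [::]
| move_R3 b1 b2 b3 i :
    (b1 = b3 -> b2 = b1) ->
    move [:: (Cross b1, i); (Cross b2, i.+1); (Cross b3, i)]
         [:: (Cross b3, i.+1); (Cross b2, i); (Cross b1, i.+1)].

Inductive isotopic : diagram -> diagram -> Prop :=
| iso_move U L L' V :
    move L L' -> tangle2 (U ++ L ++ V) -> tangle2 (U ++ L' ++ V) ->
    isotopic (U ++ L ++ V) (U ++ L' ++ V)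
| iso_refl D : isotopic D D
| iso_sym D D' : isotopic D D' -> isotopic D' D
| iso_trans D D' D'' : isotopic D D' -> isotopic D' D'' -> isotopic D D''.

Definition shift (k : nat) (D : diagram) : diagram :=
  [seq (ei.1, k + ei.2) | ei <- D].

(* T1 + T2: T1 on the strands 0, 1 and T2 on the strands 2, 3; the two NE-NW
   ends are joined above and the two SE-SW ends below. *)
Definition hcomp (D1 D2 : diagram) : diagram :=
  (Lmax, 1) :: D1 ++ shift 2 D2 ++ [:: (Lmin, 1)].

Definition vcomp (D1 D2 : diagram) : diagram := D1 ++ D2.

Definition crossing_tangle (b : bool) : diagram := [:: (Cross b, 0)].

Inductive arborescent : diagram -> Prop :=
| ar_plus : arborescent (crossing_tangle true)
| ar_minus : arborescent (crossing_tangle false)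
| ar_hcomp D1 D2 :
    arborescent D1 -> arborescent D2 -> arborescent (hcomp D1 D2)
| ar_vcomp D1 D2 :
    arborescent D1 -> arborescent D2 -> arborescent (vcomp D1 D2)
| ar_iso D D' : arborescent D -> isotopic D D' -> arborescent D'.

(* (k, p, d) is the point of the p-th strand just above the k-th piece of the
   diagram (at the very bottom if k is the number of pieces), directed
   downwards if d and upwards otherwise.  A directed arc is a class of directed
   points under the equivalence relation generated by [same_arc]. *)
Definition dpoint : Type := (nat * nat * bool)%type.

Definition on_diagram (D : diagram) (x : dpoint) : bool :=
  (x.1.1 <= size D) && (x.1.2 < width 2 (take x.1.1 D)).

Definition rev_dir (x : dpoint) : dpoint := (x.1, ~~ x.2).

Inductive same_arc (D : diagram) : dpoint -> dpoint -> Prop :=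
| arc_left k e i p d :
    onth D k = Some (e, i) -> p < i -> same_arc D (k, p, d) (k.+1, p, d)
| arc_right k e i p d :
    onth D k = Some (e, i) -> i + ins e + p < width 2 (take k D) ->
    same_arc D (k, i + ins e + p, d) (k.+1, i + outs e + p, d)
| arc_max k i d :
    onth D k = Some (Lmax, i) -> same_arc D (k.+1, i, d) (k.+1, i.+1, ~~ d)
| arc_min k i d :
    onth D k = Some (Lmin, i) -> same_arc D (k, i, d) (k, i.+1, ~~ d)
| arc_over_true k i d :
    onth D k = Some (Cross true, i) -> same_arc D (k, i, d) (k.+1, i.+1, d)
| arc_over_false k i d :
    onth D k = Some (Cross false, i) -> same_arc D (k, i.+1, d) (k.+1, i, d).

(* [crossing D x y z]: there is a crossing of D with over-arc x (in any
   direction c) and under-arcs y, z, both in the direction d. *)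
Inductive crossing (D : diagram) : dpoint -> dpoint -> dpoint -> Prop :=
| crossing_true k i c d :
    onth D k = Some (Cross true, i) ->
    crossing D (k, i, c) (k, i.+1, d) (k.+1, i, d)
| crossing_false k i c d :
    onth D k = Some (Cross false, i) ->
    crossing D (k, i.+1, c) (k, i, d) (k.+1, i.+1, d).

Local Open Scope ring_scope.
Local Open Scope quotient_scope.

Inductive side := North | South | East | West.

Inductive nrtype := NR1 | NR2.

Definition other (l : nrtype) : nrtype := if l is NR1 then NR2 else NR1.

Section Representations.

Variable C : numClosedFieldType.

Definition SL2 (X : 'M[C]_2) : Prop := \det X = 1.
Definition SL20 (X : 'M[C]_2) : Prop := SL2 X /\ \tr X = 0.

Record representation (D : diagram) (rho : dpoint -> 'M[C]_2) : Prop :=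
  Representation {
    rep_SL20 : forall x, on_diagram D x -> SL20 (rho x);
    rep_rev : forall x, on_diagram D x -> rho (rev_dir x) = invmx (rho x);
    rep_arc : forall x y, same_arc D x y -> rho x = rho y;
    rep_crossing : forall x y z, crossing D x y z ->
      rho z = rho x *m rho y *m invmx (rho x)
  }.

Definition rho_nw (D : diagram) (rho : dpoint -> 'M[C]_2) : 'M[C]_2 :=
  rho (0, 0, false)%N.
Definition rho_ne (D : diagram) (rho : dpoint -> 'M[C]_2) : 'M[C]_2 :=
  rho (0, 1, false)%N.
Definition rho_sw (D : diagram) (rho : dpoint -> 'M[C]_2) : 'M[C]_2 :=
  rho (size D, 0, true)%N.
Definition rho_se (D : diagram) (rho : dpoint -> 'M[C]_2) : 'M[C]_2 :=
  rho (size D, 1, true)%N.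

Definition rho_side (D : diagram) (rho : dpoint -> 'M[C]_2) (x : side) :
    'M[C]_2 * 'M[C]_2 :=
  match x with
  | North => (rho_nw D rho, rho_ne D rho)
  | South => (rho_sw D rho, rho_se D rho)
  | East => (rho_ne D rho, rho_se D rho)
  | West => (rho_nw D rho, rho_sw D rho)
  end.

Definition tr_v (D : diagram) (rho : dpoint -> 'M[C]_2) : C :=
  \tr (rho_nw D rho *m rho_sw D rho).
Definition tr_h (D : diagram) (rho : dpoint -> 'M[C]_2) : C :=
  \tr (rho_nw D rho *m rho_ne D rho).

Definition mx22 (x y z w : C) : 'M[C]_2 :=
  \matrix_(i, j) if i == 0 then (if j == 0 then x else y)
                 else (if j == 0 then z else w).

Definition t (a : C) : C := a + a^-1.
Definition s (a : C) : C := a - a^-1.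

Definition A1 (a : C) : 'M[C]_2 :=
  2^-1 *: mx22 (t a * 'i) (s a) (s a) (- (t a * 'i)).
Definition A : 'M[C]_2 := A1 1.
Definition B (l : nrtype) : 'M[C]_2 :=
  match l with
  | NR1 => mx22 'i 1 0 (- 'i)
  | NR2 => mx22 'i 0 1 (- 'i)
  end.

Definition pmul (P : 'M[C]_2 * 'M[C]_2) (M : 'M[C]_2) : 'M[C]_2 * 'M[C]_2 :=
  (M 0 0 *: P.1 + M 1 0 *: P.2, M 0 1 *: P.1 + M 1 1 *: P.2).

Definition Cmx (c u : C) : 'M[C]_2 := mx22 (1 + u) (- (c * u)) (c * u) (1 - u).

Definition Smx (a b : C) : 'M[C]_2 :=
  (s a)^-1 *: mx22 (s (a * b^-1)) (s b) (- s b) (s (a * b)).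

Definition conj_pair (P Q : 'M[C]_2 * 'M[C]_2) : Prop :=
  exists Z : 'M[C]_2,
    [/\ SL2 Z, Z *m P.1 *m invmx Z = Q.1 & Z *m P.2 *m invmx Z = Q.2].

Definition regular (P : 'M[C]_2 * 'M[C]_2) : Prop :=
  exists a : C,
    [/\ a != 0, \tr (P.1 *m P.2) = t a & conj_pair P (A, - A1 a)].

Definition NR (l : nrtype) (P : 'M[C]_2 * 'M[C]_2) : Prop :=
  ~ regular P /\
  exists a : C,
    [/\ a = 1 \/ a = -1, \tr (P.1 *m P.2) = t a
      & conj_pair P (A, - (a *: B l))].

(* An NR pair (X, Y) has exactly one common eigenline, and it is NR1 or NR2
   according as the eigenvalue of X on that line is 'i or - 'i.  Hence the type
   of an NR pair is kept when the eigenvalue of the first matrix is multiplied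
   by - c with c = -1, and exchanged when c = 1.  For a representation of a
   tangle with vertical and horizontal traces 2 a, 2 b and an NR end pair, the
   eigenvalues of the ends NW, SW, NE, SE on the common line are
   x, - a x, - b x, a b x.  So the four pairs need not have the same type: on
   crossing_tangle true with a = 1, West is NR1 when South is NR2. *)
Definition twist (c : C) (l : nrtype) : nrtype :=
  if c == 1 then other l else l.

Definition Cx : Type := {x : C | x != 0}.

Definition equivU (p q : Cx * Cx) : bool :=
  (val p.1 == val q.1) && (val p.2 == val q.2) ||
  (val p.1 == (val q.1)^-1) && (val p.2 == (val q.2)^-1).

Lemma equivU_refl : reflexive equivU.
Proof. by move=> p; rewrite /equivU !eqxx. Qed.

Lemma equivU_sym : symmetric equivU.
Proof.
move=> p q; rewrite /equivU ![val p.1 == _]eq_sym ![val p.2 == _]eq_sym.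
by rewrite -![_^-1 == val _](inj_eq invr_inj) !invrK.
Qed.

Lemma equivU_trans : transitive equivU.
Proof.
move=> q p r /orP[] /andP[/eqP e1 /eqP e2] /orP[] /andP[/eqP f1 /eqP f2];
  by rewrite /equivU e1 e2 f1 f2 ?invrK !eqxx ?orbT.
Qed.

Canonical equivU_equiv : equiv_rel (Cx * Cx) :=
  EquivRel equivU equivU_refl equivU_sym equivU_trans.

Definition U : Type := {eq_quot equivU}.
HB.instance Definition _ := Choice.on U.
HB.instance Definition _ : EqQuotient _ equivU U := EqQuotient.on U.

Definition classU (a b : Cx) : U := \pi_U (a, b).

Definition tU (q : U) : C * C := (t (val (repr q).1), t (val (repr q).2)).

Definition SU (q : U) : 'M[C]_2 := Smx (val (repr q).1) (val (repr q).2).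

(* The involution [a, b] |-> [b, a], so that SU (swapU [a, b]) = S_{[b, a]}. *)
Definition swapU (q : U) : U := classU (repr q).2 (repr q).1.

Lemma repr_classU (a b : Cx) : equivU (repr (classU a b)) (a, b).
Proof. by rewrite -eqmodE reprK. Qed.

Lemma tU_class (a b : Cx) : tU (classU a b) = (t (val a), t (val b)).
Proof.
have := repr_classU a b; rewrite /tU /equivU /t.
by case/orP=> /andP[/eqP-> /eqP->] //=; rewrite !invrK ![_^-1 + _]addrC.
Qed.

Lemma SU_class (a b : Cx) : SU (classU a b) = Smx (val a) (val b).
Proof.
have sV x : s x^-1 = - s x by rewrite /s invrK opprB.
have := repr_classU a b; rewrite /SU /equivU.
case/orP=> /andP[/eqP-> /eqP->] //=.
rewrite /Smx -[in LHS]invfM -invfM !sV invrN scaleNr -scalerN.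
congr (_ *: _); apply/matrixP=> i j; rewrite !mxE.
by case: ifP => _; case: ifP => _; rewrite !opprK.
Qed.

Lemma swapU_class (a b : Cx) : swapU (classU a b) = classU b a.
Proof.
apply/eqP; rewrite /swapU /classU eqmodE /=.
have := repr_classU a b; rewrite /equivU /=.
by case/orP=> /andP[-> ->]; rewrite ?orbT.
Qed.

End Representations.

(* Main.v *)
Require Import Defs.
From mathcomp Require Import all_boot all_order all_algebra.
From mathcomp Require Import reals.
From mathcomp.real_closed Require Import complex.
From mathcomp Require Import boolp generic_quotient ring zify.

Import Order.TTheory GRing.Theory Num.Theory.

(** Write p, q, r, e for the values at NW, NE, SW, SE, all directed outwards.
    Reading a diagram from top to bottom, a representation colours the strands
    by trace-zero matrices, and no elementary piece changes the ordered product
    of the colours: a crossing conjugates one factor past the other, and the two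
    ends of a maximum or minimum carry X and - X, whose product is 1.  Hence
    p q = r e, and since X^2 = -1 on trace-zero matrices, also p r = q e.

    That single identity gives everything except the rationality of u and v.
    Indeed p q commutes with p r, so if p r is not scalar then p q = x + y (p r)
    for scalars x and y ([ends_combination]); this expresses (q, e) linearly in
    (p, r), and det (p q) = 1 leaves one parameter.
    - If tr (p r) = t a with a different from 1 and -1, that parameter is
      b = x + y a, and the linear expression is - S_(a, b)
      ([ends_generic], [west_generic]).
    - If tr (p r) = 2 a with a = 1 or a = -1, put d = p + a r.  It is nilpotent,
      and the pair (p, r) is NR exactly when d is nonzero, the type being given
      by the eigenvalue of p on the image of d ([NR_P]).  The determinant forces
      b = x + y a to be a sign, and (q, e) = - b (p, r) C_a(u) for some complex
      number u ([ends_parabolic]).  Moreover p + b q = - u d, from which all the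
      NR assertions can be read off ([west_NR]).

    By the last formula, rationality of u says that p + b q and p + a r are
    linearly dependent over the rationals ([rational_ends]), a condition
    symmetric in the vertical and horizontal directions.  It holds for a
    crossing, and it passes to T1 + T2 because the middle pair of ends of an NR
    sum is again NR and the parameters u add up ([rational_hcomp]); T1 * T2 is
    the transposed situation.

    What remains is to transport this along isotopies and to cut a composed
    diagram into its parts.  Both are done with [color D c c'], the relation that
    some colouring of D has the colours c at the top and c' at the bottom: it is
    invariant under the moves ([isotopic_equicolor]), it splits along
    compositions ([color_cat], [color_hcomp]), and every representation of D
    gives an instance of it ([rep_color]). *)
Local Open Scope ring_scope.
Local Open Scope complex_scope.

(** * Trace-zero two by two matrices *)

Section TwoByTwo.
Set Implicit Arguments.
Unset Strict Implicit.
Variable C : numClosedFieldType.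
Implicit Types X Y Z : 'M[C]_2.

Lemma mx22_eta X : X = mx22 (X 0 0) (X 0 1) (X 1 0) (X 1 1).
Proof.
by apply/matrixP=> i j; rewrite mxE; case: i => [[|[|//]] ?];
  case: j => [[|[|//]] ?]; congr (X _ _); apply: val_inj.
Qed.

Lemma mx22P (P : 'M[C]_2 -> Prop) :
  (forall x y z w, P (mx22 x y z w)) -> forall X, P X.
Proof. by move=> PM X; rewrite (mx22_eta X). Qed.

Lemma mul22 (x y z w x' y' z' w' : C) :
  mx22 x y z w * mx22 x' y' z' w' =
  mx22 (x * x' + y * z') (x * y' + y * w') (z * x' + w * z') (z * y' + w * w').
Proof.
apply/matrixP=> i j; rewrite !mxE !big_ord_recl big_ord0 !mxE /= addr0.
by case: ifP => _; case: ifP => _.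
Qed.

Lemma add22 (x y z w x' y' z' w' : C) :
  mx22 x y z w + mx22 x' y' z' w' = mx22 (x + x') (y + y') (z + z') (w + w').
Proof. by apply/matrixP=> i j; rewrite !mxE; do 2!case: ifP => _. Qed.

Lemma opp22 (x y z w : C) : - mx22 x y z w = mx22 (- x) (- y) (- z) (- w).
Proof. by apply/matrixP=> i j; rewrite !mxE; do 2!case: ifP => _. Qed.

Lemma scale22 (c x y z w : C) :
  c *: mx22 x y z w = mx22 (c * x) (c * y) (c * z) (c * w).
Proof. by apply/matrixP=> i j; rewrite !mxE; do 2!case: ifP => _. Qed.

Lemma scalar22 (c : C) : c%:M = mx22 c 0 0 c.
Proof. by rewrite [LHS]mx22_eta !mxE. Qed.

Lemma one22 : 1 = mx22 1 0 0 1 :> 'M[C]_2.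
Proof. exact: scalar22. Qed.

Lemma zero22 : 0 = mx22 0 0 0 0 :> 'M[C]_2.
Proof. by rewrite [LHS]mx22_eta !mxE. Qed.

Lemma tr22 (x y z w : C) : \tr (mx22 x y z w) = x + w.
Proof. by rewrite /mxtrace !big_ord_recl big_ord0 !mxE /= addr0. Qed.

Lemma det22 (x y z w : C) : \det (mx22 x y z w) = x * w - y * z.
Proof.
rewrite (expand_det_row _ 0) !big_ord_recl big_ord0 /cofactor !det_mx11 !mxE /=.
by rewrite expr0 expr1; ring.
Qed.

Lemma eq22 (x y z w x' y' z' w' : C) : 
  mx22 x y z w = mx22 x' y' z' w' <-> [/\ x = x', y = y', z = z' & w = w'].
Proof.
split=> [/matrixP e|[-> -> -> ->] //].
by split; [move: (e 0 0)|move: (e 0 1)|move: (e 1 0)|move: (e 1 1)]; rewrite !mxE.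
Qed.

Definition m22E := (add22, opp22, scale22, mul22, one22, zero22, tr22, det22).

Lemma SL20_E x y z w :
  SL20 (mx22 x y z w : 'M[C]_2) <-> w = - x /\ x * x + y * z = -1.
Proof.
rewrite /SL20 /SL2 !m22E; split=> [[d /eqP]|[-> e]].
  rewrite addrC addr_eq0 => /eqP ew; split=> //.
  by rewrite -d ew; ring.
by split; [apply: oppr_inj; rewrite -e; ring | rewrite subrr].
Qed.

Lemma SL20_sqr X : SL20 X -> X * X = -1.
Proof.
elim/mx22P: X => x y z w /SL20_E[-> e]; rewrite !m22E; apply/eq22.
by split; first [ring | rewrite -e; ring].
Qed.

Lemma SL20_inv X : SL20 X -> invmx X = - X.
Proof.
move=> X0; have XX := SL20_sqr X0.
have uX : X \in unitmx by rewrite unitmxE (proj1 X0) unitr1.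
by rewrite -[RHS]mul1mx -(mulVmx uX) -mulmxA mulmxN -[X *m X]/(X * X) XX opprK mulmx1.
Qed.

Lemma SL20_anticomm X Y :
  SL20 X -> SL20 Y -> X * Y + Y * X = (\tr (X * Y)) *: 1.
Proof.
elim/mx22P: X => x y z w /SL20_E[-> _].
elim/mx22P: Y => x' y' z' w' /SL20_E[-> _].
by rewrite !m22E; apply/eq22; split; ring.
Qed.

Lemma SL20_opp X : SL20 X -> SL20 (- X).
Proof.
elim/mx22P: X => x y z w /SL20_E[-> e].
by rewrite !m22E; apply/SL20_E; rewrite -e; split; ring.
Qed.

End TwoByTwo.

(** * Regular and non-regular pairs *)

Section NormalForms.
Set Implicit Arguments.
Unset Strict Implicit.
Variable C : numClosedFieldType.
Implicit Types X Y Z : 'M[C]_2.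

Lemma mulCii : 'i * 'i = -1 :> C.
Proof. by rewrite -expr2 sqrCi. Qed.

Lemma two0 : 2 != 0 :> C.
Proof. by rewrite pnatr_eq0. Qed.

Lemma A_E : A C = mx22 'i 0 0 (- 'i).
Proof.
rewrite /A /A1 /t /s invr1 scale22; apply/eq22; have := two0.
by split; field.
Qed.

Lemma A1_sign (a : C) : a = 1 \/ a = -1 -> A1 a = a *: A C.
Proof.
move=> a1; have aV : a^-1 = a by case: a1 => ->; rewrite ?invrN invr1.
rewrite A_E /A1 /t /s aV !scale22; apply/eq22; have := two0.
by split; field.
Qed.

Lemma t_sign (a b : C) : a = 1 \/ a = -1 -> b != 0 -> t b = 2 * a -> b = a.
Proof.
move=> a1 b0; rewrite /t => e; have aa : a * a = 1 by case: a1 => ->; ring.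
apply/eqP; rewrite -subr_eq0 -[_ == 0](@expf_eq0 _ _ 2); apply/eqP.
have -> : (b - a) ^+ 2 = b * (b + b^-1 - 2 * a) + a * a - b / b by ring.
by rewrite e aa divff // subrr mulr0; ring.
Qed.

Lemma t_double (a : C) : a = 1 \/ a = -1 -> t a = 2 * a.
Proof. by rewrite /t => -[] ->; rewrite ?invrN invr1; ring. Qed.

Lemma conj_pairI Z X Y X' Y' :
  \det Z != 0 -> Z * X = X' * Z -> Z * Y = Y' * Z -> conj_pair (X, Y) (X', Y').
Proof.
move=> dZ eX eY; pose c := (sqrtC (\det Z))^-1.
have dcZ : \det (c *: Z) = 1.
  by rewrite detZ exprVn sqrtCK mulVf.
exists (c *: Z); rewrite /SL2 dcZ /=.
have uZ : c *: Z \in unitmx by rewrite unitmxE dcZ unitr1.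
split=> //.
  by rewrite -scalemxAl -[Z *m X]/(Z * X) eX -[X' * Z]/(X' *m Z) scalemxAr mulmxK.
by rewrite -scalemxAl -[Z *m Y]/(Z * Y) eY -[Y' * Z]/(Y' *m Z) scalemxAr mulmxK.
Qed.

Lemma conj_pairE X Y X' Y' : conj_pair (X, Y) (X', Y') ->
  exists2 Z, Z \in unitmx & Z * X = X' * Z /\ Z * Y = Y' * Z.
Proof.
move=> [Z [dZ /= <- <-]]; have uZ : Z \in unitmx by rewrite unitmxE dZ unitr1.
by exists Z => //; split; rewrite -[RHS]/(_ *m Z) mulmxKV.
Qed.

Lemma SL20_diagonal X : SL20 X -> exists2 Z, \det Z != 0 & Z * X = A C * Z.
Proof.
have i0 := neq0Ci C; have i2 := two0.
rewrite A_E; elim/mx22P: X => x y z w /SL20_E[-> e].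
(* The rows of X + 'i and of X - 'i are eigenvectors for 'i and - 'i; a row
   that does not vanish has to be picked from each. *)
have [y0|y0] := eqVneq y 0; last first.
  exists (mx22 (x + 'i) y (x - 'i) y); rewrite !m22E.
    have -> : (x + 'i) * y - y * (x - 'i) = 2 * 'i * y by ring.
    by rewrite !mulf_neq0.
  apply/eq22; split; try ring.
    have -> : (x + 'i) * x + y * z = (x * x + y * z) + 'i * x by ring.
    by rewrite e -mulCii; ring.
  have -> : (x - 'i) * x + y * z = (x * x + y * z) - 'i * x by ring.
  by rewrite e -mulCii; ring.
rewrite y0 mul0r addr0 in e *.
have : (x - 'i) * (x + 'i) = 0.
  have -> : (x - 'i) * (x + 'i) = x * x - 'i * 'i by ring.
  by rewrite e mulCii subrr.
move/eqP; rewrite mulf_eq0 subr_eq0 addr_eq0 => /orP[] /eqP xi; rewrite xi.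
  exists (mx22 (2 * 'i) 0 z (- 2 * 'i)); rewrite !m22E; last first.
    by apply/eq22; split; ring.
  have -> : 2 * 'i * (-2 * 'i) - 0 * z = - (2 * 2) * ('i * 'i) :> C by ring.
  by rewrite mulCii mulrN1 opprK mulf_neq0.
exists (mx22 z (2 * 'i) (- 2 * 'i) 0); rewrite !m22E; last first.
  by apply/eq22; split; ring.
have -> : z * 0 - 2 * 'i * (-2 * 'i) = (2 * 2) * ('i * 'i) :> C by ring.
by rewrite mulCii mulrN1 oppr_eq0 mulf_neq0.
Qed.

(** Diagonalising X leaves, for Y, a diagonal entry fixed by the trace of X Y and
    two off-diagonal entries whose product is fixed by the determinant; only the
    conjugations by diagonal matrices remain to adjust these two entries. *)
Lemma SL20_normal X Y : SL20 X -> SL20 Y ->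
  exists Z (x y z : C), [/\ \det Z != 0, Z * X = A C * Z,
    Z * Y = mx22 x y z (- x) * Z, \tr (X * Y) = 2 * 'i * x & x * x + y * z = -1].
Proof.
move=> X0 Y0; have [Z dZ eX] := SL20_diagonal X0.
have uZ : Z \in unitmx by rewrite unitmxE unitfE.
pose Y' : 'M[C]_2 := Z *m Y *m invmx Z.
have eY : Z * Y = Y' * Z by rewrite /Y' -[RHS]/(_ *m Z) mulmxKV.
have Y'0 : SL20 Y'.
  case: Y0 => dY tY; split; last by rewrite /Y' mxtrace_mulC mulKmx.
  by rewrite /SL2 /Y' !det_mulmx det_inv dY mulr1 divff.
have tXY : \tr (X * Y) = \tr (A C * Y').
  have -> : X * Y = invmx Z *m (A C * Y' * Z).
    by rewrite -mulrA -eY mulrA -eX -mulrA -[Z * (X * Y)]/(Z *m _) mulKmx.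
  by rewrite mxtrace_mulC -mulmxA mulmxV // mulmx1.
move: Y'0 tXY eY; elim/mx22P: Y' => x y z w /SL20_E[-> e] tXY eY.
exists Z, x, y, z; split=> //.
by rewrite tXY A_E !m22E; ring.
Qed.

(** Conjugation by diag (k, 1) trades a factor k between the two off-diagonal
    entries of Y, so two normal forms with the same diagonal are conjugate as
    soon as such a factor exists. *)
Lemma conj_pair_diag Z X Y (x y z k y' z' : C) :
  \det Z != 0 -> Z * X = A C * Z -> Z * Y = mx22 x y z (- x) * Z ->
  k != 0 -> k * y = y' -> z = k * z' ->
  conj_pair (X, Y) (A C, mx22 x y' z' (- x)).
Proof.
move=> dZ eX eY k0 ky kz; apply: (@conj_pairI (mx22 k 0 0 1 * Z)).
- by rewrite -[_ * Z]/(_ *m Z) det_mulmx det22 mulf_neq0 //; rewrite mulr1 mulr0 subr0.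
- by rewrite -mulrA eX !mulrA; congr (_ * Z); rewrite A_E !m22E; apply/eq22; split; ring.
- rewrite -mulrA eY !mulrA; congr (_ * Z); rewrite !m22E -ky kz.
  by apply/eq22; split; ring.
Qed.

Lemma regular_generic X Y (a : C) : SL20 X -> SL20 Y -> a != 0 -> s a != 0 ->
  \tr (X * Y) = t a -> regular (X, Y).
Proof.
move=> X0 Y0 a0 sa tXY; have [Z [x [y [z [dZ eX eY t2 e]]]]] := SL20_normal X0 Y0.
exists a; split=> //.
have i2 := two0; have i0 := neq0Ci C.
have ex : x = - (2^-1 * (t a * 'i)).
  apply: (mulfI (mulf_neq0 i2 i0)); rewrite -t2 tXY.
  have -> : 2 * 'i * - (2^-1 * (t a * 'i)) = - ('i * 'i) * t a by field.
  by rewrite mulCii; ring.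
have eyz : y * z = (2^-1 * s a) ^+ 2.
  have -> : y * z = -1 - x * x by rewrite -e; ring.
  have -> : x * x = 'i * 'i * (2^-1 * t a) ^+ 2 by rewrite ex; ring.
  by rewrite mulCii /t /s; field.
have yz0 : y * z != 0 by rewrite eyz expf_neq0 // mulf_neq0 // invr_eq0.
have y0 : y != 0 by apply: contraNneq yz0 => ->; rewrite mul0r.
(* The product y z fixes the square of the common off-diagonal entry, so a
   rescaling can make both entries equal to - s a / 2. *)
have -> : - A1 a = mx22 x (- (2^-1 * s a)) (- (2^-1 * s a)) (- x).
  by rewrite /A1 scale22 opp22 ex; apply/eq22; split; ring.
apply: (conj_pair_diag dZ eX eY (k := - (2^-1 * s a) / y)).
- by rewrite mulf_neq0 ?invr_eq0 // oppr_eq0 mulf_neq0 // invr_eq0.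
- by rewrite divfK.
- apply: (mulfI y0); rewrite eyz; field; exact: y0.
Qed.

Lemma regular_scalar X Y (a : C) : SL20 X -> a = 1 \/ a = -1 -> X + a *: Y = 0 ->
  regular (X, Y).
Proof.
move=> X0 a1 /eqP; have aa : a * a = 1 by case: a1 => ->; ring.
rewrite addr_eq0 => /eqP eX.
have eY : Y = - (a *: X) by rewrite eX scalerN opprK scalerA aa scale1r.
exists a; split.
- by case: a1 => ->; rewrite ?oppr_eq0 oner_eq0.
- rewrite t_double //= eY mulmxN -scalemxAr -[X *m X]/(X * X) SL20_sqr //.
  by rewrite scalerN opprK linearZ /= mxtrace1; ring.
have [Z dZ eZ] := SL20_diagonal X0.
apply: (conj_pairI dZ eZ); rewrite eY A1_sign //.
by rewrite mulrN mulNr -scalerAr -scalerAl eZ.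
Qed.

(** The eigenvalue of the first matrix on the common eigenline of an NR pair of
    type l. *)
Definition eigen (l : nrtype) : C := if l is NR1 then 'i else - 'i.

(** The conjugation-free form of the NR condition.  In the normal form (A, - a B)
    the matrix X + a Y is - E_12 for type 1 and - E_21 for type 2, and A acts on
    their images by 'i and - 'i.  Conversely, the eigenvalue equation makes one
    off-diagonal entry of Y vanish, and a diagonal conjugation normalises the
    other. *)
Lemma NR_P l X Y : SL20 X -> SL20 Y ->
  NR l (X, Y) <-> exists a : C, [/\ a = 1 \/ a = -1, \tr (X * Y) = 2 * a,
    X + a *: Y != 0 & X * (X + a *: Y) = eigen l *: (X + a *: Y)].
Proof.
move=> X0 Y0; split.
  move=> [_ [a [a1 /= tXY /conj_pairE[Z uZ [eX eY]]]]]; exists a.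
  have aa : a * a = 1 by case: a1 => ->; ring.
  pose N := A C - B C l.
  have eN : Z * (X + a *: Y) = N * Z.
    rewrite mulrDr -scalerAr eX eY mulNr -(scalerAl a) scalerN scalerA aa.
    by rewrite scale1r -mulrBl.
  have N0 : N != 0.
    apply/eqP; rewrite /N A_E; case: (l); rewrite /B !m22E => /eq22[e1 e2 e3 _].
      by move/eqP: e2; rewrite sub0r oppr_eq0 oner_eq0.
    by move/eqP: e3; rewrite sub0r oppr_eq0 oner_eq0.
  split=> //; first by rewrite -t_double.
    apply: contraNneq N0 => e0; move/eqP: eN; rewrite e0 mulr0 eq_sym => /eqP eN.
    by rewrite -[N](mulmxK uZ) -[N *m Z]/(N * Z) eN mul0mx.
  apply: (can_inj (mulKmx uZ)); rewrite -![Z *m _]/(Z * _) mulrA eX -mulrA -scalerAr.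
  rewrite eN mulrA scalerAl; congr (_ * Z).
  by rewrite /N A_E; case: (l); rewrite /B /eigen !m22E; apply/eq22; split; ring.
move=> [a [a1 tXY d0 eX]].
have aa : a * a = 1 by case: a1 => ->; ring.
have a0 : a != 0 by case: a1 => ->; rewrite ?oppr_eq0 oner_eq0.
split.
  move=> [b [b0 /= tb /conj_pairE[Z uZ [eX' eY']]]].
  have eb : b = a by apply: t_sign => //; rewrite -tb.
  case/eqP: d0; apply: (can_inj (mulKmx uZ)); rewrite -![Z *m _]/(Z * _) mulr0.
  rewrite mulrDr -scalerAr eX' eY' mulNr eb A1_sign // -(scalerAl a) scalerN scalerA aa.
  by rewrite scale1r subrr.
exists a; split=> //; first by rewrite t_double.
have [Z [x [y [z [dZ eXZ eYZ t2 e]]]]] := SL20_normal X0 Y0.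
have uZ : Z \in unitmx by rewrite unitmxE unitfE.
have i2 := two0; have i0 := neq0Ci C.
have ex : x = - (a * 'i).
  apply: (mulfI (mulf_neq0 i2 i0)); rewrite -t2 tXY.
  have -> : 2 * 'i * - (a * 'i) = - ('i * 'i) * (2 * a) by ring.
  by rewrite mulCii; ring.
pose N := mx22 0 (a * y) (a * z) 0.
have eN : Z * (X + a *: Y) = N * Z.
  rewrite mulrDr -scalerAr eXZ eYZ scalerAl -mulrDl; congr (_ * Z).
  rewrite A_E !m22E ex; apply/eq22; split; try ring.
    by rewrite mulrN mulrA aa; ring.
  by rewrite opprK mulrA aa; ring.
have N0 : N != 0.
  apply: contraNneq d0 => e0; apply/eqP; apply: (can_inj (mulKmx uZ)).
  by rewrite -![Z *m _]/(Z * _) eN e0 mul0r mulr0.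
have AN : A C * N = eigen l *: N.
  apply: (can_inj (mulmxK uZ)); rewrite -![_ *m Z]/(_ * Z) -mulrA -eN mulrA -eXZ.
  by rewrite -mulrA eX -scalerAr eN scalerAl.
have dbl (u : C) : 'i * u = - 'i * u -> u = 0.
  move/eqP; rewrite mulNr -subr_eq0 opprK -mulr2n mulrn_eq0 /= mulf_eq0.
  by rewrite (negPf i0) /= => /eqP.
rewrite A_E /N in AN; move: AN; rewrite !m22E => /eq22[_ e1 e2 _].
case: l {eX} e1 e2 => /= e1 e2.
  have az : a * z = 0 by apply: dbl; rewrite -e2; ring.
  have z0 : z = 0 by move/eqP: az; rewrite mulf_eq0 (negPf a0) => /eqP.
  have y0 : y != 0.
    by apply: contraNneq N0 => y0; rewrite /N y0 z0 !mulr0 zero22.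
  have -> : - (a *: mx22 'i 1 0 (- 'i)) = mx22 x (- a) 0 (- x).
    by rewrite !m22E ex; apply/eq22; split; ring.
  apply: (conj_pair_diag dZ eXZ eYZ (k := - a / y)).
  - by rewrite mulf_neq0 ?invr_eq0 // oppr_eq0.
  - by rewrite divfK.
  - by rewrite z0 mulr0.
have ay : a * y = 0 by apply: dbl; rewrite -[RHS]e1; ring.
have y0 : y = 0 by move/eqP: ay; rewrite mulf_eq0 (negPf a0) => /eqP.
have z0 : z != 0.
  by apply: contraNneq N0 => z0; rewrite /N y0 z0 !mulr0 zero22.
have -> : - (a *: mx22 'i 0 1 (- 'i)) = mx22 x 0 (- a) (- x).
  by rewrite !m22E ex; apply/eq22; split; ring.
apply: (conj_pair_diag dZ eXZ eYZ (k := - z / a)).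
- by rewrite mulf_neq0 ?invr_eq0 // oppr_eq0.
- by rewrite y0 mulr0.
- by rewrite mulrN divfK // opprK.
Qed.

End NormalForms.

(** * The four ends of a tangle *)

Section FourEnds.
Set Implicit Arguments.
Unset Strict Implicit.
Variable C : numClosedFieldType.
Implicit Types X Y Z p q r e : 'M[C]_2.

Lemma sign_sqr (a : C) : a = 1 \/ a = -1 -> a * a = 1.
Proof. by case=> ->; ring. Qed.

Lemma sqr_sign (a : C) : a * a = 1 -> a = 1 \/ a = -1.
Proof.
move=> aa; have : (a - 1) * (a + 1) = 0.
  have -> : (a - 1) * (a + 1) = a * a - 1 by ring.
  by rewrite aa subrr.
by move/eqP; rewrite mulf_eq0 subr_eq0 addr_eq0 => /orP[] /eqP; auto.
Qed.

(** The commutant of X is spanned by 1 and X: commuting with X forces the vector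
    of the off-diagonal entries and of the difference of the diagonal entries of
    Y to be parallel to that of X. *)
Lemma commutant22 X Y : (forall c, X <> c *: 1) -> X * Y = Y * X ->
  exists x y : C, Y = x *: 1 + y *: X.
Proof.
elim/mx22P: X => g1 g2 g3 g4; elim/mx22P: Y => y1 y2 y3 y4 nscal.
rewrite !m22E => /eq22[e1 e2 e3 e4].
have E1 : g2 * y3 = y2 * g3.
  by apply: (addrI (g1 * y1)); rewrite e1 mulrC.
have E2 : g2 * (y1 - y4) = y2 * (g1 - g4).
  have -> : g2 * (y1 - y4) = y1 * g2 + y2 * g4 - (g1 * y2 + g2 * y4) +
     y2 * (g1 - g4) by ring.
  by rewrite e2 subrr add0r.
have E3 : g3 * (y1 - y4) = y3 * (g1 - g4).
  have -> : g3 * (y1 - y4) = g3 * y1 + g4 * y3 - (y3 * g1 + y4 * g3) +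
     y3 * (g1 - g4) by ring.
  by rewrite e3 subrr add0r.
have [g20|g20] := eqVneq g2 0; last first.
  exists (y1 - y2 / g2 * g1), (y2 / g2); rewrite !m22E; apply/eq22; split.
  - by ring.
  - by rewrite mulr0 add0r divfK.
  - by apply: (mulfI g20); rewrite E1; field; exact: g20.
  - apply: (mulfI g20).
    have -> : g2 * y4 = g2 * y1 - g2 * (y1 - y4) by ring.
    by rewrite E2; field; exact: g20.
have [g30|g30] := eqVneq g3 0; last first.
  exists (y1 - y3 / g3 * g1), (y3 / g3); rewrite !m22E; apply/eq22; split.
  - by ring.
  - by apply: (mulfI g30); rewrite mulrC -E1; field; exact: g30.
  - by rewrite mulr0 add0r divfK.
  - apply: (mulfI g30).
    have -> : g3 * y4 = g3 * y1 - g3 * (y1 - y4) by ring.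
    by rewrite E3; field; exact: g30.
have g14 : g1 - g4 != 0.
  apply/eqP => /eqP; rewrite subr_eq0 => /eqP g14; apply: (nscal g1).
  by rewrite g20 g30 g14 !m22E; apply/eq22; split; ring.
have y20 : y2 = 0.
  by move/esym/eqP: E2; rewrite g20 mul0r mulf_eq0 (negPf g14) orbF => /eqP.
have y30 : y3 = 0.
  by move/esym/eqP: E3; rewrite g30 mul0r mulf_eq0 (negPf g14) orbF => /eqP.
exists (y1 - (y1 - y4) / (g1 - g4) * g1), ((y1 - y4) / (g1 - g4)).
rewrite g20 g30 y20 y30 !m22E; apply/eq22; split; try ring.
by field; exact: g14.
Qed.

(** The equation says that the colour products at the top and at the bottom of
    the tangle agree; the two signs of the inward-directed upper ends cancel. *)
Record ends p q r e : Prop := Ends {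
  ends_nw : SL20 p; ends_ne : SL20 q; ends_sw : SL20 r; ends_se : SL20 e;
  ends_mul : p * q = r * e
}.

Lemma mulKN X Y : SL20 X -> X * (X * Y) = - Y.
Proof. by move=> X0; rewrite mulrA SL20_sqr // mulN1r. Qed.

Lemma mulNK X Y : SL20 X -> Y * X * X = - Y.
Proof. by move=> X0; rewrite -mulrA SL20_sqr // mulrN1. Qed.

(** The symmetry of [ends] under reflection in the diagonal through NW and SE. *)
Lemma ends_mul_v p q r e : ends p q r e -> p * r = q * e.
Proof.
move=> [p0 q0 r0 e0 m].
have -> : q = - (p * (r * e)) by rewrite -m mulKN // opprK.
by rewrite mulNr -!mulrA SL20_sqr // mulrN1 mulrN opprK.
Qed.

Lemma ends_transpose p q r e : ends p q r e -> ends p r q e.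
Proof. by move=> E; have m := ends_mul_v E; case: E. Qed.

Lemma ends_flip p q r e : ends p q r e -> ends q p e r.
Proof.
move=> E; have m := ends_mul_v E; case: E => p0 q0 r0 e0 m'; split=> //.
by rewrite -[e]opprK -(mulKN e q0) -m mulNr !mulrA mulNK // opprK.
Qed.

Lemma SL20_tri p r : SL20 p -> SL20 r -> r * p * r = (\tr (p * r)) *: r + p.
Proof.
move=> p0 r0; have := SL20_anticomm p0 r0; rewrite addrC => /(canRL (addrK _)) ->.
by rewrite mulrBl -mulrA SL20_sqr // -scalerAl mul1r mulrN1 opprK.
Qed.

(** Both p r and p q are expressed by the same two products, so they commute, and
    p q is a combination x + y (p r).  Multiplying by p and r gives q and e, and
    the constraint on (x, y) is det (p q) = 1. *)
Lemma ends_combination p q r e : ends p q r e -> (forall c, p * r <> c *: 1) ->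
  exists x y : C, [/\ q = y *: r - x *: p,
    e = - (y *: p) - (x + y * \tr (p * r)) *: r,
    x * x + x * y * \tr (p * r) + y * y = 1 &
    \tr (p * q) = 2 * x + y * \tr (p * r)].
Proof.
move=> E nscal; have m := ends_mul_v E; case: E => p0 q0 r0 e0 m'.
have cm : p * r * (p * q) = p * q * (p * r).
  have -> : p * r * (p * q) = - (p * e) by rewrite m' -mulrA mulKN // mulrN.
  by rewrite m -mulrA mulKN // mulrN.
have [x [y xy]] := commutant22 nscal cm.
exists x, y; split.
- have -> : q = - (p * (p * q)) by rewrite mulKN // opprK.
  rewrite xy mulrDr -!scalerAr mulr1 mulKN //.
  by apply/matrixP=> i j; rewrite !mxE; ring.
- have -> : e = - (r * (p * q)) by rewrite m' mulKN // opprK.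
  rewrite xy mulrDr -!scalerAr mulr1 mulrA SL20_tri //.
  by apply/matrixP=> i j; rewrite !mxE; ring.
- have [[dp _] [dq _] [dr _]] := And3 p0 q0 r0.
  have : \det (p * q) = 1 by rewrite det_mulmx dp dq mulr1.
  have : \det (p * r) = 1 by rewrite det_mulmx dp dr mulr1.
  rewrite xy; elim/mx22P: (p * r) => x1 x2 x3 x4; rewrite !m22E => d1 d2.
  rewrite -[RHS]d2; apply/eqP; rewrite -subr_eq0; apply/eqP.
  transitivity (y * y * (1 - (x1 * x4 - x2 * x3))); first by ring.
  by rewrite d1 subrr mulr0.
- by rewrite xy mxtraceD !linearZ /= mxtrace1; ring.
Qed.

Lemma scalar_product p r (c : C) : SL20 p -> SL20 r -> p * r = c *: 1 ->
  [/\ c = 1 \/ c = -1, \tr (p * r) = 2 * c & p + c *: r = 0].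
Proof.
move=> p0 r0 pr; have er : r = - (c *: p).
  by rewrite -[r]opprK -(mulKN r p0) pr -scalerAr mulr1.
have cc : c * c = 1.
  have [dp _] := p0; have [dr _] := r0; move: (dr).
  by rewrite er -scaleNr /SL2 detZ dp expr2 mulr1 mulrNN.
split; first exact: sqr_sign.
- by rewrite pr linearZ /= mxtrace1; ring.
- by rewrite er scalerN scalerA cc scale1r subrr.
Qed.

(** Here the determinant constraint of [ends_combination] is the perfect square
    (x + y a)^2 = 1, so b is x + y a. *)
Lemma ends_parabolic p q r e (a : C) : ends p q r e -> a = 1 \/ a = -1 ->
  \tr (p * r) = 2 * a -> p + a *: r != 0 ->
  exists b u : C, [/\ b = 1 \/ b = -1, \tr (p * q) = 2 * b,
    q = - b *: (p + u *: (p + a *: r)) &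
    e = - b *: (r - (a * u) *: (p + a *: r))].
Proof.
move=> E a1 tpr d0; have aa := sign_sqr a1.
have nscal c : p * r <> c *: 1.
  have [p0 _ r0 _ _] := E.
  move=> /(scalar_product p0 r0)[_ e1 e2].
  by case/eqP: d0; rewrite -e2; congr (_ + _ *: _); apply: (mulfI (two0 C)); rewrite -tpr.
have [x [y [eq ee dxy tpq]]] := ends_combination E nscal.
rewrite tpr in ee dxy tpq; pose b := x + y * a.
have bb : b * b = 1.
  have -> : b * b = x * x + x * y * (2 * a) + y * y * (a * a) by rewrite /b; ring.
  by rewrite aa mulr1.
exists b, (- b * y * a); split; first exact: sqr_sign.
- by rewrite tpq /b; ring.
- rewrite eq; apply/matrixP=> i j; rewrite !mxE.
  have -> : - b * (p i j + - b * y * a * (p i j + a * r i j)) =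
    - b * p i j + (b * b) * (y * a) * p i j + (b * b) * y * (a * a) * r i j by ring.
  by rewrite aa bb /b; ring.
- rewrite ee; apply/matrixP=> i j; rewrite !mxE.
  have -> : - b * (r i j - a * (- b * y * a) * (p i j + a * r i j)) =
    - b * r i j - (b * b) * (a * a) * y * p i j - (b * b) * (a * a) * (a * y) * r i j by ring.
  by rewrite aa bb /b; ring.
Qed.

(** Since p + b q = - u (p + a r) when p + a r is nonzero, this says that u is
    rational, in a form that is symmetric in the two directions and also makes
    sense when p + a r vanishes. *)
Definition rational_ends p q r : Prop :=
  forall a b : C, a = 1 \/ a = -1 -> b = 1 \/ b = -1 ->
  \tr (p * r) = 2 * a -> \tr (p * q) = 2 * b ->
  exists x y : rat, (x != 0) || (y != 0) /\
    ratr x *: (p + b *: q) = ratr y *: (p + a *: r).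

Lemma rational_transpose p q r : rational_ends p q r -> rational_ends p r q.
Proof.
move=> H a b a1 b1 ta tb; have [x [y [xy e]]] := H b a b1 a1 tb ta.
by exists y, x; rewrite orbC.
Qed.

Lemma rational_parabolic p q r e (a : C) : ends p q r e -> rational_ends p q r ->
  a = 1 \/ a = -1 -> \tr (p * r) = 2 * a -> p + a *: r != 0 ->
  exists (b : C) (u : rat), [/\ b = 1 \/ b = -1, \tr (p * q) = 2 * b,
    q = - b *: (p + ratr u *: (p + a *: r)) &
    e = - b *: (r - (a * ratr u) *: (p + a *: r))].
Proof.
move=> E Q a1 tpr d0.
have [b [u [b1 tpq eq ee]]] := ends_parabolic E a1 tpr d0.
have [x [y [xy exy]]] := Q _ _ a1 b1 tpr tpq.
have {exy} : (ratr x * u + ratr y) *: (p + a *: r) = 0.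
  rewrite scalerDl -exy eq; apply/matrixP=> i j; rewrite !mxE.
  by case: b1 => ->; ring.
move/eqP; rewrite scaler_eq0 (negPf d0) orbF => /eqP exy.
have x0 : x != 0.
  apply: contraTneq xy => x0; rewrite x0 eqxx /= negbK.
  by move/eqP: exy; rewrite x0 rmorph0 mul0r add0r fmorph_eq0.
have eu : u = ratr (- y / x).
  have x0' : ratr x != 0 :> C by rewrite fmorph_eq0.
  apply: (mulfI x0'); apply: (addIr (ratr y)); rewrite exy.
  by rewrite fmorph_div rmorphN mulrC divfK // addNr.
by exists b, (- y / x); rewrite -eu.
Qed.

(** If d = p + a r is nonzero, the left tangle gives m and k as - b' (p + u d) and
    - b' (r - a u d), so the left ends (- m, - k) of the right tangle have the
    nonzero difference vector b' d, and its parameter v adds to u. *)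
Lemma rational_hcomp p m r k q e :
  ends p m r k -> ends (- m) q (- k) e ->
  rational_ends p m r -> rational_ends (- m) q (- k) -> rational_ends p q r.
Proof.
move=> E1 E2 Q1 Q2 a b a1 b1 tpr tpq.
have aa := sign_sqr a1.
have [d0|d0] := eqVneq (p + a *: r) 0.
  by exists 0, 1; rewrite d0 rmorph0 scale0r scaler0.
have [b' [u [b'1 tpm em ek]]] := rational_parabolic E1 Q1 a1 tpr d0.
have b'b' := sign_sqr b'1.
have ed : - m + a *: - k = b' *: (p + a *: r).
  rewrite em ek; apply/matrixP=> i j; rewrite !mxE.
  by case: a1 => ->; ring.
have d0' : - m + a *: - k != 0.
  rewrite ed scaler_eq0 negb_or d0 andbT.
  by case: b'1 => ->; rewrite ?oppr_eq0 oner_eq0.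
have tmk : \tr (- m * - k) = 2 * a.
  by rewrite mulrNN -(ends_mul_v E1).
have [b'' [v [b''1 _ eq _]]] := rational_parabolic E2 Q2 a1 tmk d0'.
rewrite ed in eq.
have {}eq : q = - (b' * b'') *: (p + ratr (u + v) *: (p + a *: r)).
  rewrite eq {1}em rmorphD; apply/matrixP=> i j; rewrite !mxE.
  by ring.
have tpd : \tr (p * (p + a *: r)) = 0.
  have [p0 _ _ _ _] := E1.
  rewrite mulrDr SL20_sqr // -scalerAr linearD /= linearN linearZ /= mxtrace1 tpr.
  by rewrite mulrCA aa; ring.
have eb : b = b' * b''.
  apply: (mulfI (two0 C)); rewrite -tpq eq -scalerAr mulrDr -(scalerAr (ratr _)).
  have [p0 _ _ _ _] := E1.
  rewrite SL20_sqr // linearZ linearD /= linearN linearZ /= tpd mulr0 addr0.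
  by rewrite mxtrace1; ring.
exists 1, (- (u + v)); split=> //.
rewrite eq -eb rmorph1 scale1r rmorphN; apply/matrixP=> i j; rewrite !mxE.
by case: b1 => ->; ring.
Qed.

(** If p + a r vanishes then p r = q e is scalar, so q + a e vanishes as well;
    otherwise the new difference vectors are signs times the old ones. *)
Lemma rational_flip p q r e : ends p q r e -> rational_ends p q r ->
  rational_ends q p e.
Proof.
move=> E Q a b a1 b1 tqe tqp.
have tpr : \tr (p * r) = 2 * a by rewrite (ends_mul_v E).
have tpq : \tr (p * q) = 2 * b by rewrite -tqp -[q * p]/(q *m p) mxtrace_mulC.
have bb := sign_sqr b1.
have [d0|d0] := eqVneq (p + a *: r) 0.
  exists 0, 1; split=> //; rewrite rmorph0 rmorph1 scale0r scale1r.
  have aa := sign_sqr a1; have [p0 q0 r0 e0 _] := E.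
  have pr : p * r = a *: 1.
    move/eqP: d0; rewrite addr_eq0 => /eqP ->.
    by rewrite mulNr -scalerAl SL20_sqr // scalerN opprK.
  have qe : q * e = a *: 1 by rewrite -(ends_mul_v E).
  have [_ _ <-] := scalar_product q0 e0 qe; by [].
have [b' [u [b'1 tpq' eq ee]]] := rational_parabolic E Q a1 tpr d0.
have eb : b' = b by apply: (mulfI (two0 C)); rewrite -tpq' tpq.
rewrite {}eb {tpq' b'1} in eq ee.
exists 1, u; split=> //; rewrite rmorph1 scale1r eq ee.
by apply/matrixP=> i j; rewrite !mxE; case: a1 => ->; case: b1 => ->; ring.
Qed.

Lemma twistK (b : C) l : twist b (twist b l) = l.
Proof. by rewrite /twist; case: eqP => // _; case: l. Qed.

Lemma eigen_twist (b : C) l : b = 1 \/ b = -1 ->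
  eigen C (twist b l) = - b * eigen C l.
Proof.
rewrite /twist; case=> ->; first by rewrite eqxx; case: l => /=; ring.
rewrite -subr_eq0 -opprD oppr_eq0 (_ : 1 + 1 = 2 :> C) ?(negPf (two0 C)); last by ring.
by case: l => /=; ring.
Qed.

Lemma NR_trace l X Y : SL20 X -> SL20 Y -> NR l (X, Y) ->
  exists2 a : C, a = 1 \/ a = -1 & \tr (X * Y) = 2 * a.
Proof. by move=> X0 Y0 /(NR_P _ X0 Y0)[a [a1 tXY _ _]]; exists a. Qed.

Lemma NR_sign l X Y (a : C) : SL20 X -> SL20 Y -> a = 1 \/ a = -1 ->
  \tr (X * Y) = 2 * a ->
  NR l (X, Y) <->
  X + a *: Y != 0 /\ X * (X + a *: Y) = eigen C l *: (X + a *: Y).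
Proof.
move=> X0 Y0 a1 tXY; split=> [/(NR_P _ X0 Y0)[b [_ tb]]|[d0 dX]].
  have -> // : b = a by apply: (mulfI (two0 C)); rewrite -tb tXY.
by apply/NR_P => //; exists a.
Qed.

Lemma nilpotent_sign X Y (b : C) : SL20 X -> SL20 Y -> b = 1 \/ b = -1 ->
  \tr (X * Y) = 2 * b -> (X + b *: Y) * (X + b *: Y) = 0.
Proof.
move=> X0 Y0 b1 tXY; have := SL20_anticomm X0 Y0; rewrite tXY.
move/(canRL (addKr _)) => eYX.
rewrite mulrDl !mulrDr -!scalerAl -!scalerAr !SL20_sqr // eYX.
apply/matrixP=> i j; move: (X * Y) => M; rewrite !mxE.
by case: b1 => ->; ring.
Qed.

(** As X + b Y squares to zero, Y acts on its image as - b X does. *)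
Lemma NR_swap l X Y (b : C) : SL20 X -> SL20 Y -> b = 1 \/ b = -1 ->
  \tr (X * Y) = 2 * b -> NR l (X, Y) -> NR (twist b l) (Y, X).
Proof.
move=> X0 Y0 b1 tXY /(NR_sign _ X0 Y0 b1 tXY)[d0 eX].
have bb := sign_sqr b1.
have b0 : b != 0 by case: b1 => ->; rewrite ?oppr_eq0 oner_eq0.
have ed : Y + b *: X = b *: (X + b *: Y).
  by rewrite scalerDr scalerA bb scale1r addrC.
apply/(NR_sign _ Y0 X0 b1).
  by rewrite -tXY -[Y * X]/(Y *m X) mxtrace_mulC.
rewrite ed scaler_eq0 negb_or b0 d0; split=> //.
rewrite -scalerAr -{1}[Y](addrK (b *: X)) ed mulrBl -!scalerAl.
rewrite nilpotent_sign // scaler0 sub0r.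
by rewrite eX eigen_twist // scalerN !scalerA -scaleNr; congr (_ *: _); ring.
Qed.

End FourEnds.

(** * End pairs of non-regular and of generic representations *)

Section EndPairs.
Set Implicit Arguments.
Unset Strict Implicit.
Variable C : numClosedFieldType.
Implicit Types X Y Z p q r e : 'M[C]_2.

(** With d = p + a r, the difference vectors of the pairs (q, e), (p, q) and (r, e)
    are - b d, - u d and a u d.  All these pairs share the eigenline of (p, r),
    and they are NR exactly when the coefficient of d is nonzero. *)
Lemma west_NR l p q r e :
  ends p q r e -> rational_ends p q r -> NR l (p, r) ->
  exists a b : C, [/\ a = 1 \/ a = -1, b = 1 \/ b = -1,
    \tr (p * r) = 2 * a, \tr (p * q) = 2 * b &
    exists u : rat, [/\ (q, e) = - b *: pmul (p, r) (Cmx a (ratr u)),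
      NR (twist b l) (q, e) &
      u <> 0 <-> NR l (p, q) /\ NR (twist a l) (r, e)]].
Proof.
move=> E Q nr; have [p0 q0 r0 e0 m] := E.
have [a a1 tpr] := NR_trace p0 r0 nr.
have [d0 pd] := (NR_sign l p0 r0 a1 tpr).1 nr.
have [b [u [b1 tpq eq ee]]] := rational_parabolic E Q a1 tpr d0.
have aa := sign_sqr a1; have bb := sign_sqr b1.
have tqe : \tr (q * e) = 2 * a by rewrite -(ends_mul_v E).
have tre : \tr (r * e) = 2 * b by rewrite -m.
have dd := nilpotent_sign p0 r0 a1 tpr.
have sign0 (c : C) : c = 1 \/ c = -1 -> c != 0.
  by case=> ->; rewrite ?oppr_eq0 oner_eq0.
have a0 := sign0 _ a1; have b0 := sign0 _ b1.
pose d := p + a *: r; rewrite -/d in d0 pd eq ee dd.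
exists a, b; split=> //; exists u; split.
- congr (_, _); rewrite /= !mxE /=.
    by rewrite eq; apply/matrixP=> i j; rewrite !mxE; ring.
  rewrite ee; apply/matrixP=> i j; rewrite !mxE.
  by case: a1 => ->; ring.
- apply/(NR_sign _ q0 e0 a1 tqe).
  have -> : q + a *: e = - b *: d.
    rewrite eq ee /d; apply/matrixP=> i j; rewrite !mxE.
    by case: a1 => ->; ring.
  rewrite scaler_eq0 negb_or oppr_eq0 b0 d0; split=> //.
  rewrite -scalerAr eq -scalerAl mulrDl -scalerAl dd scaler0 addr0 pd.
  by rewrite eigen_twist // !scalerA; congr (_ *: _); ring.
have en : p + b *: q = - ratr u *: d.
  rewrite eq; apply/matrixP=> i j; rewrite !mxE.
  by case: b1 => ->; ring.
have es : r + b *: e = (a * ratr u) *: d.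
  rewrite ee; apply/matrixP=> i j; rewrite !mxE.
  by case: b1 => ->; ring.
split=> [/eqP u0|[/(NR_sign _ p0 q0 b1 tpq)[n0 _] _] u0]; last first.
  by move: n0; rewrite en u0 rmorph0 oppr0 scale0r eqxx.
have u0' : ratr u != 0 :> C by rewrite fmorph_eq0.
split.
  apply/(NR_sign _ p0 q0 b1 tpq).
  rewrite en scaler_eq0 negb_or oppr_eq0 u0' d0; split=> //.
  by rewrite -scalerAr pd !scalerA mulrC.
apply/(NR_sign _ r0 e0 b1 tre).
rewrite es scaler_eq0 negb_or mulf_eq0 negb_or a0 u0' d0; split=> //.
have -> : r = a *: (d - p) by rewrite /d addrC addKr scalerA aa scale1r.
rewrite -!scalerAr -scalerAl mulrBl dd sub0r pd eigen_twist //.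
by rewrite -scaleNr !scalerA; congr (_ *: _); ring.
Qed.

Lemma trmulC X Y : \tr (X * Y) = \tr (Y * X).
Proof. exact: mxtrace_mulC. Qed.

Lemma NR_swapE l X Y (b : C) : SL20 X -> SL20 Y -> b = 1 \/ b = -1 ->
  \tr (X * Y) = 2 * b -> NR l (X, Y) <-> NR (twist b l) (Y, X).
Proof.
move=> X0 Y0 b1 tXY; split; first exact: NR_swap.
by rewrite trmulC in tXY; move=> /(NR_swap Y0 X0 b1 tXY); rewrite twistK.
Qed.

Lemma east_NR l p q r e :
  ends p q r e -> rational_ends p q r -> NR l (q, e) ->
  exists a b : C, [/\ a = 1 \/ a = -1, b = 1 \/ b = -1,
    \tr (p * r) = 2 * a, \tr (p * q) = 2 * b &
    exists u : rat, [/\ (p, r) = - b *: pmul (q, e) (Cmx a (ratr u)),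
      NR (twist b l) (p, r) &
      u <> 0 <-> NR (twist b l) (p, q) /\ NR (twist a (twist b l)) (r, e)]].
Proof.
move=> E Q nr; have [p0 q0 r0 e0 m] := E.
have [a [b [a1 b1 tv th [u [e1 e2 e3]]]]] := west_NR (ends_flip E) (rational_flip E Q) nr.
exists a, b; split=> //; first by rewrite (ends_mul_v E).
  by rewrite trmulC.
exists u; split=> //.
have twistC : twist a (twist b l) = twist b (twist a l).
  by rewrite /twist; do 2!case: eqP.
rewrite twistC -(NR_swapE _ q0 p0 b1 th) -NR_swapE //.
by rewrite trmulC -m trmulC.
Qed.

Lemma t_surjective (x : C) : exists2 a : C, a != 0 & t a = x.
Proof.
pose d := sqrtC (x ^+ 2 - 4); pose a := (x + d) / 2.
have ax : a * (x - a) = 1.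
  have dd : d ^+ 2 = x ^+ 2 - 4 by rewrite sqrtCK.
  have -> : a * (x - a) = (x ^+ 2 - d ^+ 2) / 4 by rewrite /a; field.
  by rewrite dd; field.
have a0 : a != 0.
  by apply/eqP => a0; move/eqP: ax; rewrite a0 mul0r eq_sym oner_eq0.
exists a => //; apply: (mulfI a0); rewrite /t mulrDr divff //.
by rewrite -ax; ring.
Qed.

Lemma s_eq0 (a : C) : a != 0 -> s a = 0 -> a = 1 \/ a = -1.
Proof.
move=> a0 sa; apply: sqr_sign; apply/eqP; rewrite -subr_eq0.
have -> : a * a - 1 = a * s a by rewrite /s; field; exact: a0.
by rewrite sa mulr0.
Qed.

Lemma t_inj (a b : C) : a != 0 -> b != 0 -> t a = t b -> a = b \/ a = b^-1.
Proof.
move=> a0 b0 e; have : (a - b) * (a - b^-1) = 0.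
  transitivity (a * (t a - t b)); last by rewrite e subrr mulr0.
  by rewrite /t; field; rewrite a0 b0.
by move/eqP; rewrite mulf_eq0 !subr_eq0 => /orP[] /eqP; auto.
Qed.

(** The determinant constraint of [ends_combination] factors as
    (x + y a) (x + y a^-1) = 1, so b = x + y a has inverse x + y a^-1; solving
    for x and y gives the entries of S_(a, b). *)
Lemma ends_generic p q r e (a : C) : ends p q r e -> a != 0 -> s a != 0 ->
  \tr (p * r) = t a -> (forall c, p * r <> c *: 1) ->
  exists b : C, [/\ b != 0, \tr (p * q) = t b &
    (q, e) = - pmul (p, r) (Smx a b)].
Proof.
move=> E a0 sa tpr nscal.
have [x [y [eq ee dxy tpq]]] := ends_combination E nscal.
rewrite tpr in ee dxy tpq; pose b := x + y * a.
have bb : b * (x + y / a) = 1.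
  by rewrite -dxy /b /t; field.
have b0 : b != 0.
  by apply/eqP => b0; move/eqP: bb; rewrite b0 mul0r eq_sym oner_eq0.
have bV : b^-1 = x + y / a by apply: (mulfI b0); rewrite bb divff.
exists b; split=> //.
  by rewrite tpq /t bV /b; ring.
have sb : s b = y * s a by rewrite /s bV /b; ring.
have e1 : s (a * b^-1) = x * s a.
  by rewrite /s invfM invrK bV /b; field.
have e2 : s (a * b) = (x + y * t a) * s a.
  by rewrite /s /t invfM bV /b; field.
rewrite /pmul /Smx !mxE /= e1 e2 sb.
congr (_, _).
  rewrite eq mulrN !(mulrC (s a)^-1) !mulfK //.
  by apply/matrixP=> i j; rewrite !mxE; ring.
rewrite ee !(mulrC (s a)^-1) !mulfK //.
by apply/matrixP=> i j; rewrite !mxE; ring.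
Qed.

Lemma generic_not_scalar p r : SL20 p -> SL20 r ->
  \tr (p * r) <> 2 -> \tr (p * r) <> -2 -> forall c, p * r <> c *: 1.
Proof.
move=> p0 r0 n1 n2 c /(scalar_product p0 r0)[c1 tc _].
by case: c1 tc => ->; rewrite ?mulr1 ?mulrN1.
Qed.

Lemma classU_surjective (x : U C) : exists a b, x = classU a b.
Proof.
by exists (repr x).1, (repr x).2; rewrite /classU -surjective_pairing reprK.
Qed.

Lemma Smx_inv (a b : C) : Smx a^-1 b^-1 = Smx a b.
Proof.
have sV (x : C) : s x^-1 = - s x by rewrite /s invrK opprB.
rewrite /Smx -!invfM !sV invrN scaleNr -scalerN opp22.
by rewrite !opprK.
Qed.

Lemma pair_unique p r (x y x' y' : C) : SL20 p -> (forall c, p * r <> c *: 1) ->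
  x *: p + y *: r = x' *: p + y' *: r -> y = y'.
Proof.
move=> p0 nscal e; apply/eqP; rewrite -subr_eq0; apply/negPn/negP => yy.
apply: (nscal (- ((x' - x) / (y - y')))).
have er : (y - y') *: r = (x' - x) *: p.
  apply/matrixP=> i j; move/matrixP: e => /(_ i j); rewrite !mxE => e.
  transitivity (x * p i j + y * r i j - (x' * p i j + y' * r i j) +
    (x' - x) * p i j); first by ring.
  by rewrite e subrr add0r.
rewrite -[r](scalerK yy) er scalerA -scalerAr SL20_sqr //.
by rewrite scalerN scaleNr mulrC.
Qed.

(** Regularity of (p, q) and (r, e) needs an argument only if tr (p q) = 2 b with b
    a sign; then S_(a, b) is b times the identity, so q = - b p and e = - b r.
    For uniqueness, the class may be represented with the given a, and then t b
    and the entry s b of S_(a, b) determine b. *)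
Lemma west_generic p q r e : ends p q r e ->
  \tr (p * r) <> 2 -> \tr (p * r) <> -2 ->
  [/\ regular (p, r), regular (q, e), regular (p, q), regular (r, e) &
    exists! c : U C, tU c = (\tr (p * r), \tr (p * q)) /\
      (q, e) = - pmul (p, r) (SU c)].
Proof.
move=> E n1 n2; have [p0 q0 r0 e0 m] := E.
have nscal := generic_not_scalar p0 r0 n1 n2.
have [a a0 ta] := t_surjective (\tr (p * r)).
have sa : s a != 0.
  apply/eqP => /(s_eq0 a0) a1; move: n1 n2; rewrite -ta t_double //.
  by case: a1 => ->; rewrite ?mulr1 ?mulrN1.
have [b [b0 tb qe]] := ends_generic E a0 sa (esym ta) nscal.
have qe0 : s b = 0 -> q = - (b *: p) /\ e = - (b *: r).
  move=> sb; have bV : b^-1 = b by apply/esym/eqP; rewrite -subr_eq0 -/(s b) sb.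
  move: qe; rewrite /pmul /Smx !mxE /= bV sb => -[-> ->].
  have e1 : s (a * b) = b * s a by rewrite /s invfM bV; ring.
  rewrite e1 oppr0 !mulr0 !scale0r addr0 add0r (mulrC _^-1) mulfK //.
split.
- exact: regular_generic (esym ta).
- by apply: regular_generic a0 sa _ => //; rewrite -(ends_mul_v E).
- have [sb|sb] := eqVneq (s b) 0; last exact: regular_generic tb.
  have b1 := s_eq0 b0 sb.
  by apply: (regular_scalar p0 b1); rewrite (qe0 sb).1 scalerN scalerA
    sign_sqr // scale1r subrr.
- have [sb|sb] := eqVneq (s b) 0; last by apply: regular_generic sb _ => //; rewrite -m.
  have b1 := s_eq0 b0 sb.
  by apply: (regular_scalar r0 b1); rewrite (qe0 sb).2 scalerN scalerA
    sign_sqr // scale1r subrr.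
exists (classU (exist _ a a0) (exist _ b b0)); split.
  by rewrite tU_class SU_class /= ta tb.
move=> c; have [[a' a'0] [[b' b'0] ->]] := classU_surjective c.
rewrite tU_class SU_class /= => -[[ta' tb'] qe'].
have key (x y : C) : x = a -> t y = t b ->
    (q, e) = - pmul (p, r) (Smx x y) -> y = b.
  move=> -> ty; rewrite qe /pmul /Smx !mxE /= => /(congr1 (fun P => - P.1)) /=.
  rewrite !opprK => /(pair_unique p0 nscal) /(mulfI (invr_neq0 sa)) /oppr_inj st.
  apply: (mulfI (two0 C)).
  have e2 (z : C) : 2 * z = t z + s z by rewrite /t /s; ring.
  by rewrite !e2 ty st.
rewrite -ta in ta'; rewrite tb in tb'.
have [ea|ea] := t_inj a'0 a0 ta'.
  have eb := key _ _ ea tb' qe'.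
  by apply/eqP; rewrite /classU eqmodE /= /equivU /= ea eb !eqxx.
rewrite -Smx_inv in qe'.
have eb : b'^-1 = b.
  apply: key qe'; first by rewrite ea invrK.
  by rewrite -tb' /t invrK addrC.
by apply/eqP; rewrite /classU eqmodE /= /equivU /= -eb ea invrK !eqxx orbT.
Qed.

Lemma north_generic p q r e : ends p q r e ->
  \tr (p * q) <> 2 -> \tr (p * q) <> -2 ->
  [/\ regular (p, q), regular (r, e), regular (p, r), regular (q, e) &
    exists! c : U C, tU c = (\tr (p * r), \tr (p * q)) /\
      (r, e) = - pmul (p, q) (SU (swapU c))].
Proof.
move=> /ends_transpose E n1 n2.
have [h1 h2 h3 h4 [c [[tc ec] uc]]] := west_generic E n1 n2; split=> //.
have swapUK : involutive (@swapU C).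
  move=> x; have [a [b ->]] := classU_surjective x.
  by rewrite !swapU_class.
have tswap (x : U C) : tU (swapU x) = ((tU x).2, (tU x).1).
  have [a [b ->]] := classU_surjective x.
  by rewrite !swapU_class !tU_class.
exists (swapU c); split; first by rewrite tswap tc swapUK.
move=> c' [tc' ec']; rewrite (uc (swapU c')) ?swapUK //.
by split=> //; rewrite tswap tc'.
Qed.

End EndPairs.

(** * Colourings of diagrams and isotopy invariance *)

Section Colourings.
Set Implicit Arguments.
Unset Strict Implicit.
Variable C : numClosedFieldType.
Notation M := 'M[C]_2.
Implicit Types (x y z : M) (c u v w a b : seq M) (D L V : diagram) (e : piece).
Local Open Scope nat_scope.

(** As X^-1 = - X, this is x y x^-1. *)
Definition turn x y : M := (- (x * y * x))%R.

Definition all_SL20 c : Prop := forall x, x \in c -> SL20 x.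

Lemma all_SL20_cat c c' : all_SL20 (c ++ c') <-> all_SL20 c /\ all_SL20 c'.
Proof.
split=> [H|[H H'] x]; last by rewrite mem_cat => /orP[/H|/H'].
by split=> x xc; apply: H; rewrite mem_cat xc ?orbT.
Qed.

Lemma all_SL20_cons x c : all_SL20 (x :: c) <-> SL20 x /\ all_SL20 c.
Proof.
split=> [H|[H H'] y]; last by rewrite inE => /orP[/eqP ->|/H'].
by split=> [|y yc]; apply: H; rewrite inE ?eqxx // yc orbT.
Qed.

Lemma all_SL20_nil : all_SL20 [::].
Proof. by []. Qed.

Lemma turn_SL20 x y : SL20 x -> SL20 y -> SL20 (turn x y).
Proof.
move=> x0 y0; have -> : turn x y = x *m y *m invmx x.
  by rewrite SL20_inv // mulmxN.
have ux : x \in unitmx by rewrite unitmxE (proj1 x0) unitr1.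
case: x0 y0 => dx _ [dy ty]; split; last by rewrite mxtrace_mulC mulKmx.
by rewrite /SL2 !det_mulmx det_inv dx dy invr1 !mulr1.
Qed.

(** Since x^2 = -1 is central,
    passing twice under the same strand acts trivially. *)
Lemma turnK x y : SL20 x -> turn x (turn x y) = y.
Proof.
move=> x0; rewrite /turn mulrN mulNr opprK !mulrA SL20_sqr //.
by rewrite mulN1r !mulNr mulNK // opprK.
Qed.

(** Self-distributivity of conjugation, the algebraic form of the third
    Reidemeister move. *)
Lemma turn_turn x y z : SL20 x -> turn (turn x y) (turn x z) = turn x (turn y z).
Proof.
move=> x0; rewrite /turn !(mulrN, mulNr, opprK).
have xx t : (t * x * x = - t)%R by exact: mulNK.
by rewrite !mulrA !(xx, mulNr, opprK).
Qed.

Lemma turnN x y : turn (- x)%R y = turn x y.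
Proof. by rewrite /turn !(mulrN, mulNr, opprK). Qed.

Lemma turnrN x y : turn x (- y)%R = (- turn x y)%R.
Proof. by rewrite /turn !(mulrN, mulNr, opprK). Qed.

Lemma turn_self x : SL20 x -> turn x x = x.
Proof. by move=> x0; rewrite /turn SL20_sqr // mulN1r opprK. Qed.

(** The colours a above and b below a single piece; colours refer to strands
    directed downwards, which is why the two ends of an extremum have opposite
    colours. *)
Definition local e a b : Prop :=
  match e, a with
  | Lmax, [::] => exists2 x, SL20 x & b = [:: x; (- x)%R]
  | Lmin, [:: x; y] => y = (- x)%R /\ b = [::]
  | Cross true, [:: x; y] => b = [:: turn x y; x]
  | Cross false, [:: x; y] => b = [:: y; turn y x]
  | _, _ => False
  end.

Definition step e i c c' : Prop :=
  exists u a b v, [/\ size u = i, local e a b, c = u ++ a ++ v & c' = u ++ b ++ v].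

Fixpoint color D c c' : Prop :=
  if D is (e, i) :: D' then exists2 c1, step e i c c1 & color D' c1 c'
  else c = c'.

Lemma local_size e a b : local e a b -> size a = ins e /\ size b = outs e.
Proof.
by case: e => [||[]]; case: a => [|x [|y [|z a]]] //=;
  first [case=> ? ? -> | case=> _ -> | move=> -> | idtac].
Qed.

Lemma cat_inj (u v u' v' : seq M) : size u = size u' -> u ++ v = u' ++ v' ->
  u = u' /\ v = v'.
Proof. by move=> us /eqP; rewrite eqseq_cat // => /andP[/eqP -> /eqP ->]. Qed.

Lemma stepE e u a v c : size a = ins e ->
  step e (size u) (u ++ a ++ v) c <-> exists2 b, local e a b & c = u ++ b ++ v.
Proof.
move=> sa; split=> [[u' [a' [b [v' [su l e1 ->]]]]]|[b l ->]].
  have [sa' _] := local_size l.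
  have [-> e2] := cat_inj (esym su) e1.
  have [-> ->] : a = a' /\ v = v' by apply: cat_inj => //; rewrite sa.
  by exists b.
by exists u, a, b, v.
Qed.

Lemma stepE_last e u a c : size a = ins e ->
  step e (size u) (u ++ a) c <-> exists2 b, local e a b & c = u ++ b.
Proof.
move=> sa; rewrite -[in u ++ a](cats0 a); split=> [/(stepE _ _ _ sa)[b l ->]|[b l ->]].
  by exists b; rewrite ?cats0.
by apply/stepE => //; exists b; rewrite ?cats0.
Qed.

Lemma color_cat D1 D2 c c' :
  color (D1 ++ D2) c c' <-> exists2 c1, color D1 c c1 & color D2 c1 c'.
Proof.
elim: D1 c => [|[e i] D1 IH] c /=; first by split=> [h|[_ <-]] //; exists c.
split=> [[c1 st /IH[c2 h1 h2]]|[c2 [c1 st h1] h2]].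
  by exists c2 => //; exists c1.
by exists c1 => //; apply/IH; exists c2.
Qed.

Lemma step_size e i c c' : step e i c c' ->
  i + ins e <= size c /\ size c' = size c - ins e + outs e.
Proof.
move=> [u [a [b [v [<- l -> ->]]]]]; have [sa sb] := local_size l.
by rewrite !size_cat sa sb; split; lia.
Qed.

Lemma color_size D c c' : color D c c' -> size c' = width (size c) D.
Proof.
rewrite /width; elim: D c => [|[e i] D IH] c /= => [->|[c1 /step_size[_ s1] /IH ->]] //.
by rewrite s1.
Qed.

(** The ordered product is the value of the representation on a loop around all
    strands, and such a loop can be pushed across the piece. *)
Lemma local_SL20 e a b : local e a b -> all_SL20 a ->
  all_SL20 b /\ (\prod_(x <- a) x = \prod_(x <- b) x :> M)%R.
Proof.
case: e => [||[]]; case: a => [|x [|y [|z a]]] //=.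
- move=> [x x0 ->] _; rewrite !all_SL20_cons !big_cons !big_nil mulr1 mulrN SL20_sqr // opprK.
  by split=> //; exact: (conj x0 (conj (SL20_opp x0) all_SL20_nil)).
- move=> [-> ->] /all_SL20_cons[x0 _].
  by rewrite !big_cons !big_nil mulr1 mulrN SL20_sqr // opprK.
- move=> -> /all_SL20_cons[x0 /all_SL20_cons[y0 _]].
  rewrite !all_SL20_cons !big_cons !big_nil !mulr1 /turn mulNr mulNK // opprK.
  by split=> //; exact: (conj (turn_SL20 x0 y0) (conj x0 all_SL20_nil)).
- move=> -> /all_SL20_cons[x0 /all_SL20_cons[y0 _]].
  rewrite !all_SL20_cons !big_cons !big_nil !mulr1 /turn mulrN -mulrA mulKN // opprK.
  split=> //; split=> //; split=> //; rewrite mulrA; exact: turn_SL20.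
Qed.

Lemma color_SL20 D c c' : color D c c' -> all_SL20 c ->
  all_SL20 c' /\ (\prod_(x <- c) x = \prod_(x <- c') x :> M)%R.
Proof.
elim: D c => [|[e i] D IH] c /=; first by move=> ->.
move=> [c1 [u [a [b [v [_ l -> e1]]]]]]; rewrite {c1}e1 => /IH h.
move=> /all_SL20_cat[u0 /all_SL20_cat[/(local_SL20 l)[b0 p] v0]].
have [|c'0 <-] := h; first by rewrite !all_SL20_cat.
by split=> //; rewrite !big_cat /= p.
Qed.

Lemma step_frame e i u c v c' : i + ins e <= size c ->
  step e (size u + i) (u ++ c ++ v) c' <->
  exists2 c1, step e i c c1 & c' = u ++ c1 ++ v.
Proof.
move=> le_c; have ->  : c = take i c ++ take (ins e) (drop i c) ++ drop (ins e) (drop i c).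
  by rewrite !cat_take_drop.
have st : size (take i c) = i by rewrite size_takel //; lia.
have sa : size (take (ins e) (drop i c)) = ins e by rewrite size_takel // size_drop; lia.
move: (take i c) (take (ins e) (drop i c)) (drop (ins e) (drop i c)) st sa => w a w' <- sa.
rewrite -!catA [u ++ _]catA -size_cat; split.
  move=> /(stepE _ _ _ sa)[b l ->]; exists (w ++ b ++ w'); last by rewrite -!catA.
  by apply/stepE => //; exists b.
move=> [c1 /(stepE _ _ _ sa)[b l ->] ->]; apply/stepE => //.
by exists b => //; rewrite -!catA.
Qed.

(** Colouring is a local condition; this is what reduces every move to its
    few strands, and what cuts a composed diagram into its parts. *)
Lemma color_frame n m D u c v c' : wf n m D -> size c = n ->
  color (shift (size u) D) (u ++ c ++ v) c' <->
  exists2 c1, color D c c1 & c' = u ++ c1 ++ v.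
Proof.
elim: D n c => [|[e i] D IH] n c /=.
  by move=> _ _; split=> [<-|[_ <- ->]] //; exists c.
move=> /andP[le_n w] sc; rewrite -sc in le_n w; split.
  move=> [_ /(step_frame _ _ _ le_n)[c1 st ->]].
  have [_ s1] := step_size st; move=> /(IH _ _ w s1)[c2 h ->].
  by exists c2 => //; exists c1.
move=> [c2 [c1 st h] e2]; exists (u ++ c1 ++ v).
  by apply/step_frame => //; exists c1.
have [_ s1] := step_size st.
by apply/(IH _ _ w s1); exists c2.
Qed.

Lemma color_max u v D c :
  color ((Lmax, size u) :: D) (u ++ v) c =
  (exists2 x, SL20 x & color D (u ++ [:: x, (- x)%R & v]) c).
Proof.
apply: propext => /=; split.
  by move=> [c1 /(@stepE Lmax u [::] v c1 erefl)[b [x x0 ->] ->] h]; exists x.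
move=> [x x0 h]; exists (u ++ [:: x, (- x)%R & v]) => //.
by apply/(@stepE Lmax u [::] v _ erefl); exists [:: x; (- x)%R] => //; exists x.
Qed.

Lemma color_min u x y v D c :
  color ((Lmin, size u) :: D) (u ++ [:: x, y & v]) c =
  (y = (- x)%R /\ color D (u ++ v) c).
Proof.
apply: propext => /=; split.
  by move=> [c1 /(@stepE Lmin u [:: x; y] v c1 erefl)[b [-> ->] ->] h].
move=> [e h]; exists (u ++ v) => //.
by apply/(@stepE Lmin u [:: x; y] v _ erefl); exists [::].
Qed.

Lemma color_true u x y v D c :
  color ((Cross true, size u) :: D) (u ++ [:: x, y & v]) c =
  color D (u ++ [:: turn x y, x & v]) c.
Proof.
apply: propext => /=; split.
  by move=> [c1 /(@stepE (Cross true) u [:: x; y] v c1 erefl)[b -> ->] h].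
move=> h; exists (u ++ [:: turn x y, x & v]) => //.
by apply/(@stepE (Cross true) u [:: x; y] v _ erefl); exists [:: turn x y; x].
Qed.

Lemma color_false u x y v D c :
  color ((Cross false, size u) :: D) (u ++ [:: x, y & v]) c =
  color D (u ++ [:: y, turn y x & v]) c.
Proof.
apply: propext => /=; split.
  by move=> [c1 /(@stepE (Cross false) u [:: x; y] v c1 erefl)[b -> ->] h].
move=> h; exists (u ++ [:: y, turn y x & v]) => //.
by apply/(@stepE (Cross false) u [:: x; y] v _ erefl); exists [:: y; turn y x].
Qed.

Definition equicolor n L L' : Prop := forall c c', size c = n -> all_SL20 c ->
  color L c c' <-> color L' c c'.

Lemma equicolor_frame k i L L' n m m' : wf k m L -> wf k m' L' ->
  equicolor k L L' -> i + k <= n -> equicolor n (shift i L) (shift i L').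
Proof.
move=> wL wL' eL le_n c c' sc.
have -> : c = take i c ++ take k (drop i c) ++ drop k (drop i c).
  by rewrite !cat_take_drop.
have st : size (take i c) = i by rewrite size_takel //; lia.
have sa : size (take k (drop i c)) = k by rewrite size_takel // size_drop; lia.
move: (take i c) (take k (drop i c)) (drop k (drop i c)) st sa => u a v <- sa.
move=> /all_SL20_cat[_ /all_SL20_cat[a0 _]].
split=> /(color_frame _ _ _ _ sa) h.
  have [c1 /(eL _ _ sa a0) h1 ->] := h _ wL.
  by apply/(color_frame _ _ _ wL' sa); exists c1.
have [c1 /(eL _ _ sa a0) h1 ->] := h _ wL'.
by apply/(color_frame _ _ _ wL sa); exists c1.
Qed.

(** Both orders amount to colouring the two pieces independently. *)
Lemma equicolor_far e1 e2 d : equicolor (ins e1 + d + ins e2)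
  [:: (e1, 0); (e2, outs e1 + d)] [:: (e2, ins e1 + d); (e1, 0)].
Proof.
move=> c c' sc _.
have -> : c = take (ins e1) c ++ take d (drop (ins e1) c) ++ drop d (drop (ins e1) c).
  by rewrite !cat_take_drop.
have sa : size (take (ins e1) c) = ins e1 by rewrite size_takel //; lia.
have sw : size (take d (drop (ins e1) c)) = d by rewrite size_takel // size_drop; lia.
have sb : size (drop d (drop (ins e1) c)) = ins e2 by rewrite !size_drop; lia.
move: (take _ c) (take d (drop _ c)) (drop d (drop _ c)) sa sw sb => a w b sa sw sb.
transitivity (exists a' b', [/\ local e1 a a', local e2 b b' & c' = a' ++ w ++ b']).
  split=> /=.
    move=> [c1 /(stepE [::] _ _ sa)[a' la ->] [c2 st <-]].
    have [_ sa'] := local_size la.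
    move: st; rewrite -sa' -sw -size_cat cat0s catA => /(stepE_last _ _ sb)[b' lb ->].
    by exists a', b'; rewrite -catA.
  move=> [a' [b' [la lb ->]]]; have [_ sa'] := local_size la.
  exists (a' ++ w ++ b); first by apply/(stepE [::] _ _ sa); exists a'.
  exists (a' ++ w ++ b') => //; rewrite -sa' -sw -size_cat !catA.
  by apply/(stepE_last _ _ sb); exists b'.
split=> /=.
  move=> [a' [b' [la lb ->]]]; exists (a ++ w ++ b').
    rewrite -sa -sw -size_cat !catA.
    by apply/(stepE_last _ _ sb); exists b'.
  by exists (a' ++ w ++ b') => //; apply/(stepE [::] _ _ sa); exists a'.
move=> [c1 st [c2 st' <-]]; move: st st'.
rewrite -sa -sw -size_cat catA => /(stepE_last _ _ sb)[b' lb ->].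
rewrite -catA => /(stepE [::] _ _ sa)[a' la ->].
by exists a', b'.
Qed.

Lemma color_true0 x y v D c : color ((Cross true, 0) :: D) [:: x, y & v] c =
  color D [:: turn x y, x & v] c.
Proof. exact: (color_true [::]). Qed.

Lemma color_true1 z x y v D c : color ((Cross true, 1) :: D) [:: z, x, y & v] c =
  color D [:: z, turn x y, x & v] c.
Proof. exact: (color_true [:: z]). Qed.

Lemma color_false0 x y v D c : color ((Cross false, 0) :: D) [:: x, y & v] c =
  color D [:: y, turn y x & v] c.
Proof. exact: (color_false [::]). Qed.

Lemma color_false1 z x y v D c : color ((Cross false, 1) :: D) [:: z, x, y & v] c =
  color D [:: z, y, turn y x & v] c.
Proof. exact: (color_false [:: z]). Qed.

Lemma color_max0 v D c : color ((Lmax, 0) :: D) v c =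
  (exists2 x, SL20 x & color D [:: x, (- x)%R & v] c).
Proof. exact: (color_max [::]). Qed.

Lemma color_max1 z v D c : color ((Lmax, 1) :: D) (z :: v) c =
  (exists2 x, SL20 x & color D [:: z, x, (- x)%R & v] c).
Proof. exact: (color_max [:: z]). Qed.

Lemma color_min0 x y v D c : color ((Lmin, 0) :: D) [:: x, y & v] c =
  (y = (- x)%R /\ color D v c).
Proof. exact: (color_min [::]). Qed.

Lemma color_min1 z x y v D c : color ((Lmin, 1) :: D) [:: z, x, y & v] c =
  (y = (- x)%R /\ color D (z :: v) c).
Proof. exact: (color_min [:: z]). Qed.

Definition crossE := (color_true0, color_true1, color_false0, color_false1).

Lemma equicolor_R2 t : equicolor 2 [:: (Cross t, 0); (Cross (~~ t), 0)] [::].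
Proof.
move=> [|x [|y []]] // c' _ /all_SL20_cons[x0 /all_SL20_cons[y0 _]].
by case: t; rewrite !crossE turnK.
Qed.

Lemma equicolor_R3 t1 t2 t3 : (t1 = t3 -> t2 = t1) ->
  equicolor 3 [:: (Cross t1, 0); (Cross t2, 1); (Cross t3, 0)]
              [:: (Cross t3, 1); (Cross t2, 0); (Cross t1, 1)].
Proof.
move=> ht [|x [|y [|z []]]] // c' _.
move=> /all_SL20_cons[x0 /all_SL20_cons[y0 /all_SL20_cons[z0 _]]].
by case: t1 ht; case: t2; case: t3 => ht; rewrite !crossE;
  (* Besides the two excluded cases, the strand that ends up twice turned is
     compared directly, or after turning back by the middle strand. *)
  first [by have := ht erefl | by rewrite ?turn_turn ?turnK |
    by rewrite -[turn _ (turn (turn _ _) _)]turn_turn ?turnK ].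
Qed.

Lemma equicolor_R1_max t : equicolor 0 [:: (Lmax, 0); (Cross t, 0)] [:: (Lmax, 0)].
Proof.
move=> [|//] c' _ _; rewrite !color_max0.
have tE x : SL20 x -> color [:: (Cross t, 0)] [:: x; (- x)%R] c' =
    color [::] [:: (- x)%R; x] c'.
  by move=> x0; case: t; rewrite crossE ?turnN ?turnrN turn_self.
split=> -[x x0 h]; exists (- x)%R; rewrite ?opprK; do ?[exact: SL20_opp].
  by move: h; rewrite tE.
by rewrite -[X in [:: _; X]]opprK tE ?opprK //; exact: SL20_opp.
Qed.

Lemma equicolor_R1_min t : equicolor 2 [:: (Cross t, 0); (Lmin, 0)] [:: (Lmin, 0)].
Proof.
move=> [|x [|y []]] // c' _ /all_SL20_cons[x0 /all_SL20_cons[y0 _]].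
rewrite color_min0; case: t; rewrite crossE color_min0.
  split=> -[e h]; split=> //.
    by rewrite -(turnK y x0) -[turn x y]opprK -e turnrN turn_self.
  by rewrite e turnrN turn_self // opprK.
split=> -[e h]; split=> //.
  by rewrite -(turnK x y0) e turnrN turn_self // opprK.
by rewrite e turnN turn_self // opprK.
Qed.

Lemma equicolor_slide_max t :
  equicolor 1 [:: (Lmax, 0); (Cross t, 1)] [:: (Lmax, 1); (Cross (~~ t), 0)].
Proof.
move=> [|z []] // c' _ /all_SL20_cons[z0 _].
rewrite color_max0 color_max1.
case: t; split=> -[x x0 h]; move: h; rewrite crossE => h.
- by exists x => //; rewrite crossE -[turn x z]turnN.
- by exists x => //; rewrite crossE turnN.
- exists (turn z x); first exact: turn_SL20.
  by rewrite crossE turnK // -turnrN.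
- exists (turn z x); first exact: turn_SL20.
  by rewrite crossE turnrN turnK.
Qed.

Lemma equicolor_slide_min t :
  equicolor 3 [:: (Cross t, 1); (Lmin, 0)] [:: (Cross (~~ t), 0); (Lmin, 1)].
Proof.
move=> [|x [|y [|z []]]] // c' _.
move=> /all_SL20_cons[x0 /all_SL20_cons[y0 /all_SL20_cons[z0 _]]].
case: t; rewrite !crossE color_min0 color_min1; split=> -[e h]; split=> //.
- have -> : x = (- turn y z)%R by rewrite e opprK.
  by rewrite turnrN turnK // opprK.
- by rewrite e turnrN turnK.
- by rewrite -turnN -e.
- by move: h; rewrite e turnN.
Qed.

Lemma equicolor_zigzag_l : equicolor 1 [:: (Lmax, 0); (Lmin, 1)] [::].
Proof.
move=> [|z []] // c' _ /all_SL20_cons[z0 _].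
rewrite color_max0; split=> [[x x0]|h].
  by rewrite color_min1 opprK => -[->].
exists z => //; rewrite color_min1; split; rewrite ?opprK //.
Qed.

Lemma equicolor_zigzag_r : equicolor 1 [:: (Lmax, 1); (Lmin, 0)] [::].
Proof.
move=> [|z []] // c' _ /all_SL20_cons[z0 _].
rewrite color_max1; split=> [[x x0]|h].
  by rewrite color_min0 => -[-> h]; move: h; rewrite opprK.
exists (- z)%R; first exact: SL20_opp.
by rewrite color_min0 opprK.
Qed.

Lemma wf_cat n m U V : wf n m (U ++ V) =
  wf n (width n U) U && wf (width n U) m V.
Proof.
rewrite /width; elim: U n => [|[e i] U IH] n /=; first by rewrite eqxx.
by rewrite IH andbA.
Qed.

Lemma wf_width n m D : wf n m D -> width n D = m.
Proof.
rewrite /width; elim: D n => [|[e i] D IH] n /=; first by move/eqP.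
by move=> /andP[_ /IH].
Qed.

Lemma wf_shift n m k l D : wf n m D -> wf (k + n + l) (k + m + l) (shift k D).
Proof.
elim: D n => [|[e i] D IH] n /=; first by move/eqP ->.
move=> /andP[le_n /IH]; have -> : k + (n - ins e + outs e) + l =
  k + n + l - ins e + outs e by lia.
by move=> ->; rewrite andbT; lia.
Qed.

Lemma shift0 D : shift 0 D = D.
Proof. by rewrite /shift -[RHS]map_id; apply: eq_map => -[]. Qed.

(** Well-formedness of L provides the room for the strands that a move touches;
    when the other side is the empty diagram, its colourings do not show it. *)
Lemma move_equicolor L L' n m : move L L' -> wf n m L -> equicolor n L L'.
Proof.
have framed k i L0 L0' m0 m1 L1 L1' : wf k m0 L0 -> wf k m1 L0' -> equicolor k L0 L0' ->
    shift i L0 = L1 -> shift i L0' = L1' -> i + k <= n -> equicolor n L1 L1'.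
  by move=> w w' h <- <-; exact: (equicolor_frame w w' h).
case=> [e1 e2 i d|i|i|t i|t i|t i|t i|t i|t1 t2 t3 i ht] /=.
- move=> h; apply: (framed (ins e1 + d + ins e2) i _ _ (outs e1 + d + outs e2)
      (outs e1 + d + outs e2) _ _ _ _ (@equicolor_far e1 e2 d)).
  + by rewrite /= !add0n; apply/and3P; split; lia.
  + by rewrite /= !add0n; apply/and3P; split; lia.
  + by rewrite /= addn0 addnA.
  + by rewrite /= addn0 addnA.
  + lia.
- move=> h; apply: (framed 1 i _ _ 1 1 _ _ _ _ equicolor_zigzag_l);
    rewrite //= ?addn0 ?addn1 //.
  lia.
- move=> h; apply: (framed 1 i _ _ 1 1 _ _ _ _ equicolor_zigzag_r);
    rewrite //= ?addn0 ?addn1 //.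
  lia.
- move=> h; apply: (framed 1 i _ _ 3 3 _ _ _ _ (@equicolor_slide_max t));
    rewrite //= ?addn0 ?addn1 //.
  lia.
- move=> h; apply: (framed 3 i _ _ 1 1 _ _ _ _ (@equicolor_slide_min t));
    rewrite //= ?addn0 ?addn1 //.
  lia.
- move=> h; apply: (framed 0 i _ _ 2 2 _ _ _ _ (@equicolor_R1_max t));
    rewrite //= ?addn0 ?addn1 //.
  lia.
- move=> h; apply: (framed 2 i _ _ 0 0 _ _ _ _ (@equicolor_R1_min t));
    rewrite //= ?addn0 ?addn1 //.
  lia.
- move=> h; apply: (framed 2 i _ _ 2 2 _ _ _ _ (@equicolor_R2 t));
    rewrite //= ?addn0 ?addn1 //.
  lia.
- move=> h; apply: (framed 3 i _ _ 3 3 _ _ _ _ (@equicolor_R3 _ _ _ ht));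
    rewrite //= ?addn0 ?addn1 //.
  lia.
Qed.

Lemma isotopic_equicolor D D' : isotopic D D' -> equicolor 2 D D'.
Proof.
elim=> [U L L' V mv wU wU'|D1|D1 D2 _ IH|D1 D2 D3 _ IH1 _ IH2] c c' sc c0 //.
- have eqL c1 c2 : color U c c1 -> color L c1 c2 <-> color L' c1 c2.
    move=> hU; have s1 := color_size hU; rewrite sc in s1.
    have [c10 _] := color_SL20 hU c0.
    move: wU; rewrite /tangle2 !wf_cat => /and3P[_ wL _].
    exact: (@move_equicolor _ _ _ _ mv wL c1 c2 s1 c10).
  split=> /color_cat[c1 hU /color_cat[c2 hL hV]]; apply/color_cat;
    by exists c1 => //; apply/color_cat; exists c2 => //; apply/(eqL _ _ hU).
- by have := IH c c' sc c0; tauto.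
- by rewrite IH1 // IH2.
Qed.

Lemma isotopic_tangle2 D D' : isotopic D D' -> tangle2 D <-> tangle2 D'.
Proof.
elim=> [U L L' V _ -> ->|D1|D1 D2 _ IH|D1 D2 D3 _ IH1 _ IH2] //.
  by split=> /IH.
by rewrite IH1.
Qed.

Lemma tangle2_hcomp D1 D2 : tangle2 D1 -> tangle2 D2 -> tangle2 (hcomp D1 D2).
Proof.
move=> w1 w2; have w1' : wf 4 4 D1 by rewrite -[D1]shift0; exact: (wf_shift 0 2 w1).
have w2' : wf 4 4 (shift 2 D2) by exact: (wf_shift 2 0 w2).
rewrite /tangle2; change (wf 4 2 (D1 ++ shift 2 D2 ++ [:: (Lmin, 1)])).
by rewrite wf_cat (wf_width w1') w1' wf_cat (wf_width w2') w2'.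
Qed.

Lemma tangle2_vcomp D1 D2 : tangle2 D1 -> tangle2 D2 -> tangle2 (vcomp D1 D2).
Proof. by rewrite /tangle2 /vcomp wf_cat => w1; rewrite (wf_width w1) w1. Qed.

Lemma arborescent_tangle2 D : arborescent D -> tangle2 D.
Proof.
elim=> // [D1 D2 _ w1 _ w2|D1 D2 _ w1 _ w2|D1 D2 _ w /isotopic_tangle2 <-] //.
  exact: tangle2_hcomp.
exact: tangle2_vcomp.
Qed.

Lemma size2 c : size c = 2 -> exists x y, c = [:: x; y].
Proof. by case: c => [|x [|y []]] // _; exists x, y. Qed.

(** The colours m and k are those of the two arcs that join the tangles. *)
Lemma color_hcomp D1 D2 (p q r e : M) : tangle2 D1 -> tangle2 D2 ->
  color (hcomp D1 D2) [:: p; q] [:: r; e] ->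
  exists m k, [/\ SL20 m, color D1 [:: p; m] [:: r; k] &
    color D2 [:: (- m)%R; q] [:: (- k)%R; e]].
Proof.
move=> w1 w2; rewrite /hcomp color_max1 => -[m m0 /color_cat[c1 h1]].
move=> /color_cat[c2 h2].
move: h1; rewrite -{1}[D1]shift0.
move=> /(@color_frame _ _ _ [::] [:: p; m] [:: (- m)%R; q] _ w1 erefl)[c3 h1 e1].
have := color_size h1; rewrite (wf_width w1) => /size2[r' [k e3]].
rewrite {}e3 in h1 e1; rewrite {c1}e1 in h2.
move: h2; move=> /(@color_frame _ _ _ [:: r'; k] [:: (- m)%R; q] [::] _ w2 erefl)[c4 h2 e2].
have := color_size h2; rewrite (wf_width w2) => /size2[k' [e' e4]].
rewrite {}e4 in h2 e2; rewrite {}e2 color_min1 => -[ek [er ee]].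
by exists m, k; split=> //; rewrite -?er -?ee -?ek.
Qed.

End Colourings.

(** * Rationality for arborescent tangles *)

Section Arborescent.
Set Implicit Arguments.
Unset Strict Implicit.
Variable C : numClosedFieldType.
Notation M := 'M[C]_2.
Implicit Types (p q r m k : M) (D : diagram).

Lemma color_ends D p q r e : SL20 p -> SL20 q ->
  color D [:: - p; - q] [:: r; e] -> ends p q r e.
Proof.
move=> p0 q0 h; have := color_SL20 h.
have pq0 : all_SL20 [:: - p; - q].
  by apply/all_SL20_cons; split; [|apply/all_SL20_cons; split=> //]; exact: SL20_opp.
move=> /(_ pq0)[/all_SL20_cons[r0 /all_SL20_cons[e0 _]]].
by rewrite !big_cons big_nil !mulr1 mulrNN.
Qed.

(** The under-strand gives r = - q, or r = p q p = 2 b p + q.  In both cases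
    a = - b, and p + a r is p + b q up to sign. *)
Lemma rational_crossing t p q r e : SL20 p -> SL20 q ->
  color (crossing_tangle t) [:: - p; - q] [:: r; e] -> rational_ends p q r.
Proof.
move=> p0 q0 h a b a1 b1 tpr tpq.
have tqp : \tr (q * p) = 2 * b by rewrite -tpq -[q * p]/(q *m p) mxtrace_mulC.
have [c c1 er] : exists2 c : rat, c = 1 \/ c = -1 &
    r = if c == 1 then - q else (2 * b) *: p + q.
  case: t h => h; [exists (-1) | exists 1]; auto.
    move: h; rewrite crossE => -[<- _].
    by rewrite turnN turnrN /turn opprK SL20_tri // tqp.
  by move: h; rewrite crossE => -[<- _].
have ea : a = - b.
  apply: (mulfI (two0 C)); rewrite -tpr er; case: c1 => -> /=.
    by rewrite mulrN linearN /= tpq mulrN.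
  rewrite mulrDr -scalerAr SL20_sqr // linearD linearZ /= linearN /= mxtrace1 tpq.
  by ring.
exists 1, c; split=> //; rewrite er ea.
case: c1 => -> /=; rewrite ?rmorphN rmorph1; apply/matrixP=> i j; rewrite !mxE.
  by ring.
by case: b1 => ->; ring.
Qed.

Lemma arborescent_rational D : arborescent D -> forall p q r e,
  SL20 p -> SL20 q -> color D [:: - p; - q] [:: r; e] -> rational_ends p q r.
Proof.
elim=> [p q r e p0 q0|p q r e p0 q0|D1 D2 ar1 IH1 ar2 IH2 p q r e p0 q0
  |D1 D2 ar1 IH1 ar2 IH2 p q r e p0 q0|D1 D2 ar IH iso p q r e p0 q0].
- exact: rational_crossing.
- exact: rational_crossing.
- move=> /(color_hcomp (arborescent_tangle2 ar1) (arborescent_tangle2 ar2)).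
  move=> [m [k [m0 h1 h2]]]; rewrite -[m]opprK in h1; rewrite -[- m]opprK in h2.
  have m0' := SL20_opp m0; have m0'' := SL20_opp m0'.
  have E1 := color_ends p0 m0' h1; have E2 := color_ends m0'' q0 h2.
  exact: rational_hcomp E1 E2 (IH1 _ _ _ _ p0 m0' h1) (IH2 _ _ _ _ m0'' q0 h2).
- move=> /color_cat[c h1 h2].
  have := color_size h1; rewrite (wf_width (arborescent_tangle2 ar1)).
  move=> /size2[m [k ec]]; rewrite {c}ec in h1 h2.
  have E1 := color_ends p0 q0 h1; have [_ _ m0 k0 _] := E1.
  have m0' := SL20_opp m0; have k0' := SL20_opp k0.
  rewrite -[m]opprK -[k]opprK in h2; have E2 := color_ends m0' k0' h2.
  apply: rational_transpose.
  apply: (rational_hcomp (ends_transpose E1) (ends_transpose E2)).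
    exact: rational_transpose (IH1 _ _ _ _ p0 q0 h1).
  exact: rational_transpose (IH2 _ _ _ _ m0' k0' h2).
- move=> h; apply: (IH p q r e) => //; apply/(isotopic_equicolor iso) => //.
  by apply/all_SL20_cons; split; [|apply/all_SL20_cons; split=> //]; exact: SL20_opp.
Qed.

End Arborescent.

(** * From representations to colourings *)

Section Representations.
Set Implicit Arguments.
Unset Strict Implicit.
Variable C : numClosedFieldType.
Notation M := 'M[C]_2.
Local Open Scope nat_scope.
Variables (D : diagram) (rho : dpoint -> M).
Implicit Types (k p : nat) (x y z : M).
Hypothesis rho_rep : representation D rho.

Definition row k : seq M :=
  [seq rho (k, p, true) | p <- iota 0 (width 2 (take k D))].

Lemma rep_opp k p : k <= size D -> p < width 2 (take k D) ->
  rho (k, p, false) = (- rho (k, p, true))%R.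
Proof.
move=> le_k lt_p; have o : on_diagram D (k, p, true) by rewrite /on_diagram /= le_k.
by have := rep_rev rho_rep o; rewrite SL20_inv //; exact: (rep_SL20 rho_rep o).
Qed.

Lemma rep_turn k p x y z : k <= size D -> p < width 2 (take k D) ->
  x = rho (k, p, true) ->
  z = (x *m y *m invmx x)%R -> z = turn x y.
Proof.
move=> le_k lt_p -> ->; have o : on_diagram D (k, p, true) by rewrite /on_diagram /= le_k.
by rewrite SL20_inv ?mulmxN //; exact: (rep_SL20 rho_rep o).
Qed.

Lemma rep_step U e i V : D = U ++ (e, i) :: V -> i + ins e <= width 2 U ->
  step e i (row (size U)) (row (size U).+1).
Proof.
move=> eD le_n; pose k := size U.
have on : onth D k = Some (e, i) by rewrite eD onth_cat ltnn subnn.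
have tk : take k D = U by rewrite eD take_size_cat.
have tk1 : take k.+1 D = rcons U (e, i).
  by rewrite eD -cat_rcons take_size_cat // size_rcons.
have lt_k : k < size D by rewrite eD size_cat /= -addSnnS leq_addr.
pose l := width 2 U - (i + ins e).
have w0 : width 2 U = i + (ins e + l) by rewrite /l; lia.
have w1 : width 2 (rcons U (e, i)) = i + (outs e + l).
  by rewrite /width -cats1 foldl_cat /= -/(width 2 U) w0; lia.
exists [seq rho (k, p, true) | p <- iota 0 i],
  [seq rho (k, p, true) | p <- iota i (ins e)],
  [seq rho (k.+1, p, true) | p <- iota i (outs e)],
  [seq rho (k, p, true) | p <- iota (i + ins e) l].
split.
- by rewrite size_map size_iota.
- have D1 p : p < outs e + i -> p < width 2 (take k.+1 D) by rewrite tk1 w1; lia.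
  have D0 p : p < ins e + i -> p < width 2 (take k D) by rewrite tk w0; lia.
  case: e on {eD le_n tk1 l w0 w1} D0 D1 => [||[]] on D0 D1 /=.
  + exists (rho (k.+1, i, true)).
      by apply: (rep_SL20 rho_rep); rewrite /on_diagram /= lt_k D1.
    rewrite -rep_opp ?D1 //.
    by rewrite (rep_arc rho_rep (arc_max false on)).
  + rewrite -rep_opp ?D0 1?ltnW //; split=> //.
    by rewrite (rep_arc rho_rep (arc_min false on)).
  + rewrite -(rep_arc rho_rep (arc_over_true true on)).
    congr [:: _; _]; apply: (rep_turn (ltnW lt_k) _ erefl); first exact: D0.
    exact: (rep_crossing rho_rep (crossing_true true true on)).
  + rewrite -(rep_arc rho_rep (arc_over_false true on)).
    congr [:: _; _]; apply: (rep_turn (ltnW lt_k) _ erefl); first exact: D0.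
    exact: (rep_crossing rho_rep (crossing_false true true on)).
- by rewrite /row tk w0 !iotaD !map_cat add0n.
- rewrite /row tk1 w1 !iotaD !map_cat add0n; congr (_ ++ (_ ++ _)).
    apply/eq_in_map => p; rewrite mem_iota add0n => /andP[_ lt_p].
    by rewrite (rep_arc rho_rep (arc_left true on lt_p)).
  rewrite -[i + outs e]addn0 -[i + ins e]addn0 !iotaDl -!map_comp.
  apply/eq_in_map => p; rewrite mem_iota add0n => /andP[_ lt_p] /=.
  rewrite (rep_arc rho_rep (@arc_right D k e i p true on _)) // tk w0; lia.
Qed.

Lemma rep_color : tangle2 D -> color D (row 0) (row (size D)).
Proof.
suff H V U : D = U ++ V -> wf 2 2 D -> color V (row (size U)) (row (size D)).
  by move=> w; apply: (H D [::]).
elim: V U => [|[e i] V IH] U eD w /=; first by rewrite eD cats0.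
exists (row (size U).+1).
  apply: (rep_step eD); move: w; rewrite eD wf_cat => /andP[_] /=.
  by case/andP.
by rewrite -(size_rcons U (e, i)); apply: IH; rewrite // cat_rcons.
Qed.

End Representations.

Lemma rep_ends (C : numClosedFieldType) D (rho : dpoint -> 'M[C]_2) :
  arborescent D -> representation D rho ->
  let p := rho_nw D rho in let q := rho_ne D rho in
  let r := rho_sw D rho in let e := rho_se D rho in
  ends p q r e /\ rational_ends p q r.
Proof.
move=> ar rep p q r e; have w := arborescent_tangle2 ar.
have h := rep_color rep w.
have x0 : SL20 p by apply: (rep_SL20 rep); rewrite /on_diagram /= take0.
have y0 : SL20 q by apply: (rep_SL20 rep); rewrite /on_diagram /= take0.
have {}h : color D [:: - p; - q] [:: r; e].
  move: h; rewrite /row take0 take_size (wf_width w) /=.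
  by rewrite /p /q /rho_nw /rho_ne !(rep_opp rep) ?opprK // take0.
split; first exact: (color_ends x0 y0 h).
exact: (arborescent_rational ar x0 y0 h).
Qed.

Theorem theorem4p2 (R : realType) (D : diagram) (rho : dpoint -> 'M[R[i]]_2)
    (l : nrtype) (D_ar : arborescent D) (rho_rep : representation D rho) :
  [/\ (* (i) *)
      forall al be : side,
        (al = East /\ be = West) \/ (al = West /\ be = East) ->
        NR l (rho_side D rho al) ->
        exists a b : R[i],
          [/\ a = 1 \/ a = -1, b = 1 \/ b = -1,
              tr_v D rho = 2 * a, tr_h D rho = 2 * b
            & exists u : rat,
                [/\ rho_side D rho be
                      = - b *: pmul (rho_side D rho al) (Cmx a (ratr u)),
                    NR (twist b l) (rho_side D rho be)
                  & let lw := if al is West then l else twist b l in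
                    u <> 0 <->
                    NR lw (rho_side D rho North) /\
                    NR (twist a lw) (rho_side D rho South)]],
      (* (ii) *)
      forall al be : side,
        (al = North /\ be = South) \/ (al = South /\ be = North) ->
        NR l (rho_side D rho al) ->
        exists a b : R[i],
          [/\ a = 1 \/ a = -1, b = 1 \/ b = -1,
              tr_v D rho = 2 * a, tr_h D rho = 2 * b
            & exists v : rat,
                [/\ rho_side D rho be
                      = - a *: pmul (rho_side D rho al) (Cmx b (ratr v)),
                    NR (twist a l) (rho_side D rho be)
                  & let ln := if al is North then l else twist a l in
                    v <> 0 <->
                    NR ln (rho_side D rho West) /\
                    NR (twist b ln) (rho_side D rho East)]],
      (* (iii) *)
      tr_v D rho <> 2 /\ tr_v D rho <> -2 ->
        (forall x : side, regular (rho_side D rho x)) /\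
        exists! q : U _,
          tU q = (tr_v D rho, tr_h D rho) /\
          rho_side D rho East = - pmul (rho_side D rho West) (SU q)
    & (* (iv) *)
      tr_h D rho <> 2 /\ tr_h D rho <> -2 ->
        (forall x : side, regular (rho_side D rho x)) /\
        exists! q : U _,
          tU q = (tr_v D rho, tr_h D rho) /\
          rho_side D rho South = - pmul (rho_side D rho North) (SU (swapU q))].
Proof.
have [E Q] := rep_ends D_ar rho_rep; have Et := ends_transpose E.
have Qt := rational_transpose Q.
split.
- move=> al be [] [-> ->] nr.
    have [a [b [a1 b1 tv th [u Hu]]]] := east_NR E Q nr.
    by exists a, b; split=> //; exists u.
  have [a [b [a1 b1 tv th [u Hu]]]] := west_NR E Q nr.
  by exists a, b; split=> //; exists u.
- move=> al be [] [-> ->] nr.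
    have [b [a [b1 a1 th tv [v Hv]]]] := west_NR Et Qt nr.
    by exists a, b; split=> //; exists v.
  have [b [a [b1 a1 th tv [v Hv]]]] := east_NR Et Qt nr.
  by exists a, b; split=> //; exists v.
- move=> [n1 n2]; have [hw he hn hs hq] := west_generic E n1 n2.
  by split; [case | exact: hq].
- move=> [n1 n2]; have [hn hs hw he hq] := north_generic E n1 n2.
  by split; [case | exact: hq].
Qed.
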